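(* Let $\Lambda\subset\mathbb{Z}$. (i) If either $\Lambda$ is nonempty and periodic, or $\#(\mathbb{Z}\setminus\Lambda)<\infty$, then $\mathrm{ball}(L^1_\Lambda)$ has no extreme points. (ii) If $\Lambda$ is a Riesz set, then $\mathrm{ball}(L^1_\Lambda)$ possesses at least one extreme point.
   Context: Let $\mathbb{T}=\{z\in\mathbb{C}:|z|=1\}$ and let $m$ be the normalized arc length measure on $\mathbb{T}$. $L^1=L^1(\mathbb{T},m)$ is the space of complex-valued integrable functions with norm $\|\cdot\|_1$. For $f\in L^1$ and $k\in\mathbb{Z}$, put $\widehat f(k)=\int_{\mathbb{T}}\overline{\zeta}^{\,k}f(\zeta)\,dm(\zeta)$ and $\mathrm{spec}\,f=\{k\in\mathbb{Z}:\widehat f(k)\neq 0\}$. For $\Lambda\subset\mathbb{Z}$, define $L^1_\Lambda=\{f\in L^1:\mathrm{spec}\,f\subset\Lambda\}$, normed by $\|\cdot\|_1$. For a Banach space $X$, $\mathrm{ball}(X)=\{x\in X:\|x\|\le 1\}$. An element $x\in\mathrm{ball}(X)$ is an extreme point of $\mathrm{ball}(X)$ if it is not expressible as $x=\frac12(u+v)$ with two distinct points $u,v\in\mathrm{ball}(X)$. A set $\Lambda\subset\mathbb{Z}$ is called periodic if there is a positive integer $n$ such that $\Lambda+n=\Lambda$, where $\Lambda+n=\{k+n:k\in\Lambda\}$. Let $M(\mathbb{T})$ be the space of all finite complex Borel measures on $\mathbb{T}$. For $\mu\in M(\mathbb{T})$, put $\widehat\mu(k)=\int_{\mathbb{T}}\overline{z}^{\,k}\,d\mu(z)$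 for $k\in\mathbb{Z}$, and $\mathrm{spec}\,\mu=\{k\in\mathbb{Z}:\widehat\mu(k)\ne 0\}$. A set $\Lambda\subset\mathbb{Z}$ is called a Riesz set if every measure $\mu\in M(\mathbb{T})$ with $\mathrm{spec}\,\mu\subset\Lambda$ is absolutely continuous with respect to $m$. *)

(* Defs.v *)
From HB Require Import structures.
From mathcomp Require Import all_boot all_order all_algebra complex.
From mathcomp Require Import all_classical all_reals all_analysis.
From mathcomp Require Import measurable_realfun.

Set Implicit Arguments.
Unset Strict Implicit.
Unset Printing Implicit Defensive.

Import Order.TTheory GRing.Theory Num.Theory.
Import numFieldNormedType.Exports.

Local Open Scope classical_set_scope.
Local Open Scope ring_scope.
Local Open Scope complex_scope.

(* [R[i]^o] is [R[i]] with the topology of its norm. *)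
Definition circle_set (R : realType) : set R[i]^o := [set z | `|z| = 1].
Arguments circle_set : clear implicits.

Section circle_type.
Variable R : realType.

Lemma expi_subproof (t : R) : (cos t +i* sin t : R[i]^o) \in circle_set R.
Proof.
by rewrite inE /circle_set /= normc_def /= cos2Dsin2 sqrtr1.
Qed.

Definition expi_pt (t : R) : circle_set R := SigSub (expi_subproof t).

HB.instance Definition _ := isPointed.Build (circle_set R) (expi_pt 0).

End circle_type.

(* The Borel sigma-algebra of the subspace topology. *)
Definition circle (R : realType) :=
  g_sigma_algebraType (@open (circle_set R : topologicalType)).

HB.instance Definition _ (R : realType) := Measurable.copy (circle R)
  (g_sigma_algebraType (@open (circle_set R : topologicalType))).

Definition cval (R : realType) (z : circle R) : R[i] := set_val z.

Definition expi (R : realType) (t : measurableTypeR R) : circle R := expi_pt t.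

Section expi_measurable.
Variable R : realType.

Lemma continuous_cis : continuous (fun t : R => cos t +i* sin t : R[i]^o).
Proof.
move=> t; apply/(@cvgrPdist_lt _ R[i]^o) => e e0.
have [er ep] : (complex.Re e)%:C = e /\ 0 < complex.Re e.
  by case: e e0 => a b; rewrite ltcE /= => /andP[/eqP -> a0].
have d0 : 0 < complex.Re e / 2 by rewrite divr_gt0.
have /cvgrPdist_lt/(_ _ d0) hc := @continuous_cos R t.
have /cvgrPdist_lt/(_ _ d0) hs := @continuous_sin R t.
near=> s.
rewrite -er.
have -> : (cos t +i* sin t) - (cos s +i* sin s) =
  (cos t - cos s)%:C + 'i * (sin t - sin s)%:C :> R[i] by simpc.
apply: (le_lt_trans (ler_normD _ _)).
rewrite normrM !normc_def /= !(expr0n,expr1n,addr0,add0r) /= sqrtr1 mul1r.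
rewrite !sqrtr_sqr -rmorphD /= ltcR [ltRHS]splitr ltrD //.
  by near: s; exact: hc.
by near: s; exact: hs.
Unshelve. all: by end_near. Qed.

Lemma measurable_expi : measurable_fun [set: measurableTypeR R] (@expi R).
Proof.
apply: (@measurability _ _ _ (circle R) _ _
  (@open (circle_set R : topologicalType)) erefl).
move=> _ [U [V oV <-] <-]; rewrite setTI.
apply: (@open_measurable R); apply: open_comp oV => t _; exact: continuous_cis.
Qed.

HB.instance Definition _ :=
  isMeasurableFun.Build _ _ _ _ (@expi R) measurable_expi.

Lemma two_pi_gt0 : 0 < 2 * pi :> R.
Proof. by rewrite mulr_gt0 ?pi_gt0. Qed.

(* Normalized arc length: the image of the uniform law on [0, 2 pi] under
   t |-> e^(it). *)
Definition arc_length : probability (circle R) R :=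
  distribution (uniform_prob two_pi_gt0) (@expi R).

End expi_measurable.

Section L1.
Variable R : realType.
Implicit Types (f g : circle R -> R[i]) (L : set int).

Notation m := (@arc_length R).

(* [L1 f]: f represents an element of L^1; elements of L^1 are classes of such
   functions modulo m-almost everywhere equality. *)
Definition L1 f : Prop :=
  m.-integrable setT (fun z => (complex.Re (f z))%:E) /\
  m.-integrable setT (fun z => (complex.Im (f z))%:E).

Definition norm1 f : R := Rintegral m setT (fun z => Normc.normc (f z)).

Definition cintegral d (T : measurableType d) (mu : {measure set T -> \bar R})
    (f : T -> R[i]) : R[i] :=
  Rintegral mu setT (fun z => complex.Re (f z)) +i*
  Rintegral mu setT (fun z => complex.Im (f z)).

Definition conj_pow (k : int) (z : circle R) : R[i] := (cval z)^* ^ k.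

Definition fourier f (k : int) : R[i] :=
  cintegral m (fun z => conj_pow k z * f z).

Definition spec f : set int := [set k | fourier f k != 0].

Definition L1_spec L : set (circle R -> R[i]) :=
  [set f | L1 f /\ spec f `<=` L].

Definition unit_ball L : set (circle R -> R[i]) :=
  [set f | L1_spec L f /\ norm1 f <= 1].

(* Equality and distinctness are those of elements of L^1, i.e. m-a.e. *)
Definition extreme_point (B : set (circle R -> R[i])) f : Prop :=
  B f /\
  ~ exists u v, [/\ B u, B v, ~ ae_eq m setT u v &
      ae_eq m setT f (fun z => 2^-1 * (u z + v z))].

End L1.

Definition periodic_set (L : set int) : Prop :=
  exists n : nat, (0 < n)%N /\ [set k + n%:Z | k in L] = L.

Section complex_measures.
Variable R : realType.

(* A finite complex Borel measure mu, given by its real and imaginary parts,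
   which are finite signed measures (charges are finite-valued). *)
Record complex_measure := ComplexMeasure {
  cm_Re : {charge set (circle R) -> \bar R} ;
  cm_Im : {charge set (circle R) -> \bar R} }.

(* Integral of a real function against a signed measure, through its Jordan
   decomposition; the value does not depend on the Hahn decomposition chosen. *)
Definition charge_integral (nu : {charge set (circle R) -> \bar R})
    (g : circle R -> R) : R :=
  let: exist P exN := cid (Hahn_decomposition nu) in
  let: exist N nuPN := cid exN in
  Rintegral (jordan_pos nuPN) setT g - Rintegral (jordan_neg nuPN) setT g.

Definition cm_integral (mu : complex_measure) (g : circle R -> R[i]) : R[i] :=
  let re := fun z => complex.Re (g z) in
  let im := fun z => complex.Im (g z) in
  (charge_integral (cm_Re mu) re - charge_integral (cm_Im mu) im) +i*
  (charge_integral (cm_Re mu) im + charge_integral (cm_Im mu) re).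

Definition fourier_measure (mu : complex_measure) (k : int) : R[i] :=
  cm_integral mu (conj_pow k).

Definition spec_measure (mu : complex_measure) : set int :=
  [set k | fourier_measure mu k != 0].

Definition abs_continuous (mu : complex_measure) : Prop :=
  cm_Re mu `<< @arc_length R /\ cm_Im mu `<< @arc_length R.

Definition Riesz_set (L : set int) : Prop :=
  forall mu : complex_measure, spec_measure mu `<=` L -> abs_continuous mu.

End complex_measures.

(* Main.v *)
(* (ii) Test functions are bounded functions on the circle that become continuous
   after composition with t |-> e^(it). A countable family phi_n of such functions
   is norming for L^1, so Phi(f) = sum_n 2^-n (Re int phi_n f)^2 is strictly convex
   and a maximizer of Phi over the ball is an extreme point. A maximizer exists by
   weak compactness: along an ultrafilter, the four positive parts of a maximizing
   sequence have limiting distribution functions, whose Lebesgue-Stieltjes measures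
   give a complex measure with spectrum in L; as L is a Riesz set, Radon-Nikodym
   turns it into an element of L^1, and it stays in the ball because its norm is
   computed by test functions.

   (i) If f <> 0 and h is a real function with |h| <= 1, int |f| h = 0 and h f in
   L^1_L nonzero, then f is the midpoint of f (1 + h) and f (1 - h), which have the
   same norm as f. If L + n = L take h = Re (c z^n) for a suitable c; if L is
   cofinite take h = p(Re z) with p a real polynomial satisfying finitely many
   linear conditions. *)

Require Import Defs.
From HB Require Import structures.
From mathcomp Require Import all_boot all_order all_algebra complex.
From mathcomp Require Import all_classical all_reals all_analysis.
From mathcomp Require Import measurable_realfun ring lra.

Set Implicit Arguments.
Unset Strict Implicit.
Unset Printing Implicit Defensive.

Import Order.TTheory GRing.Theory Num.Theory.
Import numFieldNormedType.Exports.

Local Open Scope classical_set_scope.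
Local Open Scope ring_scope.

(** * Weak limits of positive densities on the circle *)

(** The obstacle in (ii) is that the unit ball of L^1 is in general not weakly compact: mass may
    concentrate and leave a singular limit. The limit is therefore first formed as a measure, and
    the Riesz hypothesis is invoked once, to exclude a singular part. The limit measure comes from
    an argument of Helly type. Along an ultrafilter every bounded function has a limit, so
    distribution functions converge at all points at once, without a diagonal extraction. Their
    limit is monotone but may fail to be right-continuous; replacing it by its right limits changes
    fine Riemann sums by little. Countability of the test family forces rational coefficients and
    thresholds. Such combinations need not be bounded by 1, so they are projected onto the unit
    disc; the projection is controlled by the approximation error. In (i) the perturbation [h] is a
    nonzero polynomial in z and its conjugate, so its zeros on the circle form a finite, hence null,
    set, and [h f] vanishes only if [f] does. The class of 0 escapes this argument and is the
    midpoint of a character and its negative. *)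

Lemma ultra_bounded_cvg (R : realType) (T : Type) (U : set_system T) (M : R)
    (a : T -> R) :
  UltraFilter U -> (forall x, `|a x| <= M) ->
  exists2 l, `|l| <= M & a @ U --> l.
Proof.
move=> UU aM.
have UaU : UltraFilter (a @ U).
  split=> [|G PG aUG]; first exact: fmap_proper_filter.
  apply/seteqP; split=> [A GA|]; last exact: aUG.
  have [//|UA] := in_ultra_setVsetC (a @^-1` A) UU.
  have GCA : G (~` A) by apply: aUG.
  have : G set0 by rewrite -(setICr A); exact: filterI.
  by move/filter_not_empty.
have /= := @segment_compact R (- M) M; rewrite compact_ultra => /(_ (a @ U) UaU).
case=> [|l [/=]].
  by apply: (@filterS _ U _ setT); [move=> x _ /=; rewrite in_itv/= -ler_norml|exact: filterT].
by rewrite in_itv/= -ler_norml => lM al; exists l.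
Qed.

(** Compactness of the segment in its covering form. Only [x] is confined to the segment, so [y] may
    cross an end point. *)
Lemma segment_modulus (R : realType) (g : R -> R) (a b e : R) :
  continuous g -> 0 < e ->
  exists2 d, 0 < d & forall x y, a <= x <= b -> `|x - y| < d -> `|g x - g y| < e.
Proof.
move=> cg e0; have e2 : 0 < e / 2 by rewrite divr_gt0.
have /compact_near_coveringP := @segment_compact R a b.
move=> /(_ R (0^'+) (fun d x => forall y, `|x - y| < d -> `|g x - g y| < e)).
case=> [x _|d /= d0 dP].
  have /cvgrPdist_lt/(_ _ e2)/nbhs_ballP[r /= r0 rP] := cg x.
  exists (ball x (r / 2), [set d | d < r / 2]) => /=.
    split; first by apply: nbhsx_ballx; rewrite divr_gt0.
    exists (r / 2) => /=; first by rewrite divr_gt0.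
    by move=> z /= + z0; rewrite sub0r normrN gtr0_norm.
  move=> [x' d] /= [xx' dr] y x'y.
  rewrite -(subrKA (g x)) (le_lt_trans (ler_normD _ _))// [ltRHS]splitr ltrD//.
    rewrite distrC; apply: rP; rewrite /ball/= in xx' *.
    by rewrite (lt_trans xx')// ltr_pdivrMr// ltr_pMr// ltr1n.
  apply: rP; rewrite /ball/= in xx' *.
  rewrite -(subrKA x') (le_lt_trans (ler_normD _ _))// [ltRHS]splitr ltrD//.
  exact: lt_trans dr.
exists (d / 2); first by rewrite divr_gt0.
move=> x y xab xy.
apply: (dP (d / 2)) xy => //=; last by rewrite divr_gt0.
by rewrite sub0r normrN gtr0_norm ?divr_gt0// ltr_pdivrMr// ltr_pMr// ltr1n.
Qed.

(** * Riemann sums with a weight *)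

Section riemann_sums.
Context (R : realType).
Variable mu : {measure set (measurableTypeR R) -> \bar R}.

Lemma Rintegral_itv_split (f : R -> R) (a b c : R) :
  mu.-integrable setT (EFin \o f) -> a <= b -> b <= c ->
  \int[mu]_(s in `]a, c]) f s =
  \int[mu]_(s in `]a, b]) f s + \int[mu]_(s in `]b, c]) f s.
Proof.
move=> intf ab bc.
have E : `]a, c]%classic = `]a, b] `|` `]b, c] :> set R.
  by rewrite -itv_bndbnd_setU// bnd_simp.
rewrite E Rintegral_setU//.
- by apply: integrableS intf => //; rewrite -E.
- by apply/disj_setPS => y [/=]; rewrite !in_itv/= => /andP[_ yb] /andP[]; rewrite ltNge yb.
Qed.

(** Cell by cell, [phi] differs from its value at the left node by at most [e]. The weight lets the
    same bound serve twice: for a density against [P], and with weight 1 for the limit measure. *)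
Lemma riemann_sum_error (w phi : R -> R) (t : nat -> R) (N : nat) (e : R) :
  (forall s, 0 <= w s) -> mu.-integrable setT (EFin \o w) ->
  mu.-integrable setT (EFin \o (fun s => phi s * w s)) ->
  (forall i, t i <= t i.+1) ->
  (forall i s, (i < N)%N -> t i < s <= t i.+1 -> `|phi s - phi (t i)| <= e) ->
  `| \int[mu]_(s in `]t 0%N, t N]) (phi s * w s) -
     \sum_(i < N) phi (t i) * \int[mu]_(s in `]t i, t i.+1]) w s |
  <= e * \int[mu]_(s in `]t 0%N, t N]) w s.
Proof.
move=> w0 iw ipw tnd; elim: N => [|N IH] osc.
  by rewrite big_ord0 set_itvoc0 !Rintegral_set0 subr0 normr0 mulr0.
have t0N : t 0%N <= t N.
  by elim: N {IH osc} => // n /le_trans; apply.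
rewrite (Rintegral_itv_split ipw t0N (tnd N)) (Rintegral_itv_split iw t0N (tnd N)).
rewrite big_ord_recr/= opprD addrACA mulrDr (le_trans (ler_normD _ _))//.
have IH' := IH (fun i s iN => osc i s (ltnW iN)).
rewrite lerD//.
have iw' : mu.-integrable `]t N, t N.+1] (EFin \o w) by exact: integrableS iw.
have ipw' : mu.-integrable `]t N, t N.+1] (EFin \o (fun s => phi s * w s)).
  exact: integrableS ipw.
have icw c : mu.-integrable `]t N, t N.+1] (EFin \o (fun s => c * w s)).
  rewrite [X in integrable _ _ X](_ : _ = (fun s => c%:E * (w s)%:E))%E//.
  exact: integrableZl.
rewrite -RintegralZl// -RintegralB// -RintegralZl//.
have id : mu.-integrable `]t N, t N.+1]
    (EFin \o (fun s => phi s * w s - phi (t N) * w s)).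
  by apply: (integrableB _ ipw' (icw (phi (t N)))).
apply: (le_trans (le_normr_Rintegral _ id)) => //.
apply: le_Rintegral => //; first exact: integrable_norm id.
move=> s /=; rewrite in_itv/= => tst.
by rewrite -mulrBl normrM (ger0_norm (w0 s)) ler_wpM2r// osc.
Qed.

End riemann_sums.

(* Summation by parts leaves only the jumps H - G at the nodes, of total size at
   most 1. *)
Lemma monotone_riemann_stability (R : realType) (phi G H : R -> R) (t : nat -> R)
    (N : nat) (e : R) :
  0 <= e ->
  (forall i, (i < N)%N -> `|phi (t i.+1) - phi (t i)| <= e) ->
  (forall i, G (t i) <= H (t i)) -> (forall i, H (t i) <= G (t i.+1)) ->
  H (t 0%N) = G (t 0%N) -> H (t N) = G (t N) -> (forall x, 0 <= G x <= 1) ->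
  `| \sum_(i < N) phi (t i) * (G (t i.+1) - G (t i)) -
     \sum_(i < N) phi (t i) * (H (t i.+1) - H (t i)) | <= e.
Proof.
move=> e0 osc GH HG H0 HN G01.
rewrite -sumrB.
pose d i := H (t i) - G (t i).
have -> : \sum_(i < N) (phi (t i) * (G (t i.+1) - G (t i)) -
     phi (t i) * (H (t i.+1) - H (t i))) =
   \sum_(i < N) (phi (t i.+1) - phi (t i)) * d i.+1.
  have T : \sum_(i < N) (phi (t i.+1) * d i.+1 - phi (t i) * d i) = 0.
    rewrite -(big_mkord xpredT (fun i => phi (t i.+1) * d i.+1 - phi (t i) * d i)).
    by rewrite telescope_sumr// /d HN H0 !subrr !mulr0 subrr.
  rewrite -[RHS]subr0 -[X in _ = _ - X]T -sumrB; apply: eq_bigr => i _.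
  by rewrite /d; ring.
apply: (le_trans (ler_norm_sum _ _ _)).
apply: (@le_trans _ _ (\sum_(i < N) e * (d i.+1))).
  apply: ler_sum => i _; rewrite normrM.
  rewrite (@ger0_norm _ (d _)) ?subr_ge0//.
  by rewrite ler_wpM2r ?subr_ge0// osc.
rewrite -mulr_sumr -[leRHS]mulr1 ler_wpM2l//.
(* Since [H] at a node is at most [G] at the next one, each jump is bounded by an increment of [G],
   and the increments telescope to at most 1. *)
apply: (@le_trans _ _ (\sum_(i < N) (G (t i.+2) - G (t i.+1)))).
  by apply: ler_sum => i _; rewrite /d lerB.
rewrite -(big_mkord xpredT (fun i => G (t i.+2) - G (t i.+1))).
rewrite (telescope_sumr (fun i => G (t i.+1)))//.
have /andP[_ ?] := G01 (t N.+1); have /andP[? _] := G01 (t 1%N); lra.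
Qed.

(** For nondecreasing [G] this is the limit from the right. A Stieltjes measure needs a
    right-continuous generator, which a pointwise limit of distribution functions need not be. *)
Definition right_lim (R : realType) (G : R -> R) (t : R) : R :=
  inf (G @` `]t, +oo[).

Section right_lim.
Context (R : realType).
Variable G : R -> R.
Hypothesis ndG : {homo G : x y / x <= y}.

Let has_inf_image t : has_inf (G @` `]t, +oo[).
Proof.
split; first by exists (G (t + 1)), (t + 1) => //=; rewrite in_itv/= andbT ltrDl.
by exists (G t) => _ [s /= + <-]; rewrite in_itv/= andbT => /ltW/ndG.
Qed.

Lemma right_lim_ge t : G t <= right_lim G t.
Proof.
apply: lb_le_inf; first by have [] := has_inf_image t.
by move=> _ [s /= + <-]; rewrite in_itv/= andbT => /ltW/ndG.
Qed.

Lemma right_lim_le t s : t < s -> right_lim G t <= G s.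
Proof.
move=> ts; apply: ge_inf; first by have [] := has_inf_image t.
by exists s => //=; rewrite in_itv/= andbT.
Qed.

Lemma nondecreasing_right_lim : {homo right_lim G : x y / x <= y}.
Proof.
move=> x y; rewrite le_eqVlt => /predU1P[->//|xy].
exact: le_trans (right_lim_le xy) (right_lim_ge y).
Qed.

Lemma right_lim_right_continuous a : right_lim G x @[x --> a^'+] --> right_lim G a.
Proof.
apply/cvgrPdist_lt => e e0.
have [_ [s /= + <-] Gs] := inf_adherent e0 (has_inf_image a).
rewrite in_itv/= andbT => sa.
near=> x.
have ax : a < x by near: x; exact: nbhs_right_gt.
rewrite distrC ger0_norm ?subr_ge0 ?nondecreasing_right_lim ?ltW//.
rewrite ltrBlDl (le_lt_trans _ Gs)// right_lim_le//.
Unshelve. all: by end_near. Qed.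

Lemma stieltjes_finite_measure (b : R) : 0 <= b ->
  (forall t, t <= 0 -> G t = 0) -> (forall t, b <= t -> G t = G b) ->
  exists mu : {finite_measure set (measurableTypeR R) -> \bar R},
    (forall x y, x <= y -> mu `]x, y]%classic = (right_lim G y - right_lim G x)%:E)
    /\ mu setT = (G b)%:E.
Proof.
move=> b0 G0 Gb.
pose f : cumulative R R := HB.pack (right_lim G) (isCumulative.Build R _ R
  (right_lim G) nondecreasing_right_lim right_lim_right_continuous).
pose nu := lebesgue_stieltjes_measure f.
have nuE x y : x <= y -> nu `]x, y]%classic = (right_lim G y - right_lim G x)%:E.
  move=> xy; rewrite /nu /lebesgue_stieltjes_measure /measure_extension.
  by rewrite measurable_mu_extE/=; [rewrite wlength_itv_bnd|exact: is_ocitv].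
(* The inequality is strict because the right limit at [0] may be positive: mass can pile up at the
   left end point. For the same reason the exhausting intervals below start at [- n.+1%:R], strictly
   left of [0]. *)
have rl0 x : x < 0 -> right_lim G x = 0.
  move=> x0; apply/eqP; rewrite eq_le -{2}(G0 x (ltW x0)) right_lim_ge andbT.
  by rewrite -(G0 0 (lexx 0)) right_lim_le.
have rlb x : b <= x -> right_lim G x = G b.
  move=> bx; apply/eqP; rewrite eq_le -{2}(Gb x bx) right_lim_ge andbT.
  by rewrite -(Gb (x + 1)) ?right_lim_le ?ltrDl// (le_trans bx)// lerDl.
have nuT : nu setT = (G b)%:E.
  pose I n : set (measurableTypeR R) := `]- n.+1%:R, b + n%:R]%classic.
  have IT : \bigcup_n I n = setT.
    apply/seteqP; split=> // x _; have := archi_boundP (normr_ge0 x).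
    set n := Num.bound _ => xn.
    exists n => //; rewrite /I /= in_itv/=; apply/andP; split.
      rewrite ltrNl (lt_le_trans _ (_ : n%:R <= _)) ?ler_nat//.
      by rewrite (le_lt_trans _ xn)// -normrN ler_norm.
    by rewrite (le_trans (ler_norm _))// (le_trans (ltW xn))// lerDr.
  have : (nu \o I) n @[n --> \oo] --> nu (\bigcup_n I n).
    apply: nondecreasing_cvg_mu; [by move=> n; exact: measurable_itv|by rewrite IT|].
    move=> m n mn; apply/subsetPset/subset_itv; rewrite leBSide/=.
      by rewrite lerN2 ler_nat ltnS.
    by rewrite lerD2l ler_nat.
  rewrite IT; have -> : nu \o I = cst (G b)%:E.
    apply/funext => n /=; rewrite nuE; last first.
      by rewrite (@le_trans _ _ 0)// ?oppr_le0// addr_ge0.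
    by rewrite rlb ?lerDl// rl0 ?subr0// oppr_lt0 ltr0n.
  by move=> /cvg_unique; apply => //; exact: cvg_cst.
have finnu : fin_num_fun nu.
  move=> A mA; rewrite ge0_fin_numE//.
  apply: (@le_lt_trans _ _ (nu setT)); last by rewrite nuT ltry.
  by apply: le_measure => //; rewrite inE.
pose mu : {finite_measure set (measurableTypeR R) -> \bar R} :=
  HB.pack nu (Measure.on nu) (@Measure_isFinite.Build _ _ _ nu finnu).
by exists mu; split.
Qed.

End right_lim.

Lemma integrableM_bounded d (T : measurableType d) (R : realType)
    (mu : {measure set T -> \bar R}) (h f : T -> R) (M : R) :
  measurable_fun setT h -> (forall x, `|h x| <= M) ->
  mu.-integrable setT (EFin \o f) ->
  mu.-integrable setT (EFin \o (fun x => h x * f x)).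
Proof.
move=> mh hM intf; have := @integrableMr _ _ _ mu setT measurableT h _ mh _ intf.
apply; exists M; split; rewrite ?num_real// => x Mx z _.
exact: le_trans (hM z) (ltW Mx).
Qed.

Lemma bounded_integrable d (T : measurableType d) (R : realType)
    (mu : {finite_measure set T -> \bar R}) (h : T -> R) (M : R) :
  measurable_fun setT h -> (forall x, `|h x| <= M) ->
  mu.-integrable setT (EFin \o h).
Proof.
move=> mh hM; apply: measurable_bounded_integrable => //.
  by rewrite ltey_eq fin_num_measure.
exists M; split; rewrite ?num_real// => x Mx z _.
exact: le_trans (hM z) (ltW Mx).
Qed.

Lemma Rintegral_concentrated d (T : measurableType d) (R : realType)
    (mu : {measure set T -> \bar R}) (D : set T) (f : T -> R) :
  measurable D -> mu (~` D) = 0%E -> mu.-integrable setT (EFin \o f) ->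
  \int[mu]_x f x = \int[mu]_(x in D) f x.
Proof.
move=> mD muD intf; rewrite /Rintegral (negligible_integral _ _ intf muD)//.
  by rewrite setTD setCK.
exact: measurableC.
Qed.

Lemma Rintegral_null d (T : measurableType d) (R : realType)
    (mu : {measure set T -> \bar R}) (D : set T) (f : T -> R) :
  measurable D -> mu D = 0%E -> mu.-integrable setT (EFin \o f) ->
  \int[mu]_(x in D) f x = 0.
Proof.
move=> mD muD intf; rewrite /Rintegral null_set_integral//.
by apply: measurable_funTS; case/integrableP : intf.
Qed.

Lemma ler_filter_lim (R : realFieldType) (T : Type) (U : set_system T)
    (f g : T -> R) (l l' : R) : ProperFilter U ->
  f @ U --> l -> g @ U --> l' -> (forall x, f x <= g x) -> l <= l'.
Proof.
move=> UF fl gl fg; rewrite -subr_ge0; apply: (cvgr_to_ge (cvgB gl fl)).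
apply: (@filterS _ U _ setT); last exact: filterT.
by move=> x _; rewrite subr_ge0.
Qed.

(** * Helly selection along an ultrafilter *)

Section line_weak_limit.
Context (R : realType) (T : Type) (U : set_system T).
Hypothesis UU : UltraFilter U.

Let UF : ProperFilter U := @ultra_proper _ _ UU.

Variables (P : probability (measurableTypeR R) R) (b : R).
Hypotheses (b0 : 0 <= b) (P0 : P `]-oo, 0]%classic = 0%E)
  (Pb : P `]b, +oo[%classic = 0%E).
Variable w : T -> R -> R.
Hypotheses (w0 : forall x s, 0 <= w x s)
  (iw : forall x, P.-integrable setT (EFin \o w x))
  (w1 : forall x, \int[P]_s w x s <= 1).

Let F x t := \int[P]_(s in `]-oo, t]) w x s.

Let iwS x (A : set (measurableTypeR R)) : measurable A ->
  P.-integrable A (EFin \o w x).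
Proof. by move=> mA; exact: integrableS (iw x). Qed.

Let FB x (s t : R) : s <= t -> \int[P]_(r in `]s, t]) w x r = F x t - F x s.
Proof.
move=> st; rewrite /F.
have E : `]-oo, t]%classic = `]-oo, s] `|` `]s, t] :> set (measurableTypeR R).
  by rewrite -itv_bndbnd_setU// bnd_simp.
rewrite [X in _ = X - _](_ : _ = \int[P]_(r in `]-oo, s]) w x r +
  \int[P]_(r in `]s, t]) w x r); first by rewrite addrC addKr.
rewrite E Rintegral_setU//; first by apply: iwS; rewrite -E.
by apply/disj_setPS => y [/=]; rewrite !in_itv/= => ys /andP[]; rewrite ltNge ys.
Qed.

Let ndF x : {homo F x : s t / s <= t}.
Proof. by move=> s t st; rewrite -subr_ge0 -FB// Rintegral_ge0. Qed.

Let F_lt0 x t : t <= 0 -> F x t = 0.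
Proof.
move=> t0; apply/eqP; rewrite eq_le Rintegral_ge0// andbT.
by rewrite (le_trans (ndF x t0))// /F Rintegral_null.
Qed.

Let F_gtb x t : b <= t -> F x t = F x b.
Proof.
move=> bt; apply/eqP; rewrite -subr_eq0 -FB// Rintegral_null//.
apply/eqP; rewrite -measure_le0 -Pb le_measure ?inE//.
by apply: subset_itv; rewrite bnd_simp.
Qed.

Let F_le1 x t : F x t <= 1.
Proof.
apply: le_trans (w1 x).
rewrite (@Rintegral_concentrated _ _ _ P (`]-oo, b]%classic : set (measurableTypeR R)))//.
  have [tb|/ltW bt] := leP t b; first exact: ndF.
  by rewrite (F_gtb x bt).
by rewrite setCitvl.
Qed.

Let F_norm x t : `|F x t| <= 1.
Proof. by rewrite ger0_norm ?F_le1// Rintegral_ge0. Qed.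

(** The distribution functions [F x] converge pointwise to some [G], and [right_lim G] generates
    [mu]. Both integrals are compared with Riemann sums over one fixed finite set of nodes, where
    pointwise convergence of [F] is enough. *)
Lemma line_weak_limit :
  exists mu : {finite_measure set (measurableTypeR R) -> \bar R},
  forall phi : R -> R, continuous phi -> (forall s, `|phi s| <= 1) ->
    \int[P]_s (phi s * w x s) @[x --> U] --> \int[mu]_s phi s.
Proof.
have exG t : exists l : R, F x t @[x --> U] --> l.
  by have [l _] := ultra_bounded_cvg UU (fun x => F_norm x t); exists l.
pose G t := projT1 (cid (exG t)).
have FG t : F x t @[x --> U] --> G t by rewrite /G; case: cid.
have ndG : {homo G : s t / s <= t}.
  move=> s t st; apply: (ler_filter_lim UF (FG s) (FG t)).
  by move=> x; exact: ndF.
have G0 t : t <= 0 -> G t = 0.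
  move=> t0; have /= E : (fun x => F x t) = cst 0 by apply/funext => x; exact: F_lt0.
  by have := FG t; rewrite E => /(cvg_unique (@Rhausdorff R)); apply; exact: cvg_cst.
have Gb t : b <= t -> G t = G b.
  move=> bt; have E : (fun x => F x t) = F ^~ b by apply/funext => x; exact: F_gtb.
  by have := FG t; rewrite E => /(cvg_unique (@Rhausdorff R)); apply; exact: FG.
have G01 t : 0 <= G t <= 1.
  apply/andP; split; first apply: (ler_filter_lim UF (cvg_cst 0) (FG t)).
    by move=> x; rewrite Rintegral_ge0.
  exact: (@ler_filter_lim _ _ U (F ^~ t) (cst 1) _ _ UF (FG t) (cvg_cst _)).
have [mu [muE muT]] := stieltjes_finite_measure ndG b0 G0 Gb.
exists mu => phi cphi phi1.
have mphi : measurable_fun setT (phi : measurableTypeR R -> R).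
  exact: continuous_measurable_fun.
apply/cvgrPdist_le => eps eps0.
(* Four errors: the Riemann sum of the density ([SF]), that of [mu] ([Smu]), the exchange of [G] for
   [right_lim G] ([SG]), and the convergence of [S (F x)] to [S G]. *)
pose e := eps / 4; have e0 : 0 < e by rewrite divr_gt0.
(* The margin around [[0, b]] keeps a possible jump of [G] at [0] strictly inside, so that [G] and
   [right_lim G] agree at both extreme nodes, as [monotone_riemann_stability] requires. *)
have [d d0 dP] := @segment_modulus _ phi (- 1) (b + 1) e cphi e0.
have b2 : 0 < b + 2 by rewrite ltr_wpDl.
have := archi_boundP (ltW (divr_gt0 b2 d0)).
case: (Num.bound _) => [|N]; first by rewrite ltNge divr_ge0 ?ltW.
rewrite ltr_pdivrMr// => Nd.
pose del := (b + 2) / N.+1%:R.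
have del0 : 0 < del by rewrite divr_gt0.
have deld : del < d by rewrite /del ltr_pdivrMr// mulrC.
pose t i := - 1 + i%:R * del.
have tS i : t i.+1 = t i + del by rewrite /t -natr1; ring.
have tlt i : t i < t i.+1 by rewrite tS ltrDl.
have t0 : t 0%N = - 1 by rewrite /t mul0r addr0.
have tN : t N.+1 = b + 1 by rewrite /t /del mulrC divfK ?pnatr_eq0//; ring.
have tge i : - 1 <= t i by rewrite /t lerDl mulr_ge0// ltW.
have tle i : (i <= N.+1)%N -> t i <= b + 1.
  by rewrite -tN /t lerD2l ler_pM2r// ler_nat.
have osc i s : (i < N.+1)%N -> t i < s <= t i.+1 -> `|phi s - phi (t i)| <= e.
  move=> iN /andP[ts st]; rewrite distrC ltW// dP//.
    by rewrite tge tle// ltnW.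
  by rewrite ltr0_norm ?subr_lt0// opprB ltrBlDl (le_lt_trans st)// tS ltrD2l.
pose I : set (measurableTypeR R) := `]t 0%N, t N.+1]%classic.
have CI : ~` I = `]-oo, t 0%N] `|` `]t N.+1, +oo[ by rewrite /I setCitv.
have PCI : P (~` I) = 0%E.
  rewrite CI; apply/eqP; rewrite -measure_le0.
  rewrite (le_trans (measureU2 _ _ _))// -[leRHS]addr0 leeD//.
    by rewrite -P0 le_measure ?inE//; apply: subset_itv; rewrite // bnd_simp t0 lerN10.
  by rewrite -Pb le_measure ?inE//; apply: subset_itv; rewrite // bnd_simp tN lerDl.
have rl0 : right_lim G (t 0%N) = 0.
  apply/eqP; rewrite eq_le; apply/andP; split.
    by rewrite -(G0 0 (lexx _)) right_lim_le// t0 ltrN10.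
  by rewrite -(G0 (t 0%N)) ?right_lim_ge// t0 lerN10.
have rlN : right_lim G (t N.+1) = G b.
  have btN : b <= t N.+1 by rewrite tN lerDl.
  apply/eqP; rewrite eq_le; apply/andP; split.
    rewrite -(Gb (t N.+2)) ?right_lim_le//.
    by rewrite (le_trans btN)// ltW.
  by rewrite -(Gb _ btN) right_lim_ge.
have tt : t 0%N <= t N.+1 by rewrite t0 tN (le_trans (lerN10 _))// addr_ge0.
have muI : mu I = (G b)%:E by move: (muE _ _ tt); rewrite rl0 rlN subr0.
have muCI : mu (~` I) = 0%E.
  have mI : measurable I by exact: measurable_itv.
  transitivity (mu setT - mu I)%E; last by rewrite muT muI -EFinB subrr.
  rewrite -setTD measureD// ?setTI//.
  by apply: (@le_lt_trans _ _ (mu setT)); [rewrite le_measure ?inE|rewrite muT ltry].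
have ipw x : P.-integrable setT (EFin \o (fun s => phi s * w x s)).
  exact: integrableM_bounded (iw x).
have iphi : mu.-integrable setT (EFin \o phi) by exact: bounded_integrable.
have mI : measurable I by exact: measurable_itv.
pose S (H : R -> R) := \sum_(i < N.+1) phi (t i) * (H (t i.+1) - H (t i)).
have SF x : `| \int[P]_s (phi s * w x s) - S (F x) | <= e.
  rewrite (Rintegral_concentrated mI PCI (ipw x)).
  have := riemann_sum_error (w0 x) (iw x) (ipw x) (fun i => ltW (tlt i)) osc.
  under eq_bigr do rewrite FB ?ltW//.
  move=> /le_trans; apply; rewrite -[leRHS]mulr1 ler_wpM2l ?(ltW e0)//.
  rewrite -(Rintegral_concentrated mI PCI (iw x))//.
have Smu : `| \int[mu]_s phi s - S (right_lim G) | <= e.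
  have i1 : mu.-integrable setT (EFin \o cst 1).
    by apply: (@bounded_integrable _ _ _ _ _ 1) => // ?; rewrite normr1.
  have ip1 : mu.-integrable setT (EFin \o (fun s => phi s * cst 1 s)).
    by rewrite [X in EFin \o X](_ : _ = phi)//; apply/funext => s; rewrite mulr1.
  rewrite (Rintegral_concentrated mI muCI iphi).
  have Rmu i : \int[mu]_(s in `]t i, t i.+1]) cst 1 s =
      right_lim G (t i.+1) - right_lim G (t i).
    rewrite Rintegral_cst; last exact: measurable_itv.
    by rewrite mul1r; exact: (congr1 fine (muE _ _ (ltW (tlt i)))).
  have := riemann_sum_error (fun=> ler01) i1 ip1 (fun i => ltW (tlt i)) osc.
  under eq_Rintegral do rewrite mulr1.
  under eq_bigr do rewrite Rmu.
  move=> /le_trans; apply; rewrite -[leRHS]mulr1 ler_wpM2l ?(ltW e0)//.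
  have -> : \int[mu]_(s in I) cst 1 s = G b by rewrite Rintegral_cst// mul1r; exact: (congr1 fine muI).
  by case/andP: (G01 b).
have SG : `| S G - S (right_lim G) | <= e.
  apply: monotone_riemann_stability => //.
  - exact: ltW.
  - by move=> i iN; apply: osc => //; rewrite tlt lexx.
  - by move=> i; exact: right_lim_ge.
  - by move=> i; exact: right_lim_le.
  - by rewrite rl0 G0// t0 lerN10.
  - by rewrite rlN Gb// tN lerDl.
have SFG : S (F x) @[x --> U] --> S G.
  apply: cvg_big => [|i _]; first exact: add_continuous.
  by apply: cvgMr; apply: cvgB; exact: FG.
move/cvgrPdist_le : SFG => /(_ _ e0); apply: filterS => x SFGx.
have := SF x; move: SFGx Smu SG; rewrite !ler_norml /e.
move=> /andP[? ?] /andP[? ?] /andP[? ?] /andP[? ?]; apply/andP; split; lra.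
Qed.

End line_weak_limit.

(** * Transfer from the line to the circle *)

Definition circle_test (R : realType) (p : circle R -> R) : Prop :=
  [/\ measurable_fun setT p, continuous (fun t : R => p (expi t)) &
      forall z, `|p z| <= 1].

Section arc_length.
Context (R : realType).
Notation m := (@arc_length R).
Notation P := (uniform_prob (@two_pi_gt0 R)).

Lemma uniform_prob_le0 : P `]-oo, 0]%classic = 0%E.
Proof.
rewrite /uniform_prob integral_uniform_pdf.
have -> : `]-oo, 0]%classic `&` `[0, 2 * pi] = [set (0 : R)].
  apply/seteqP; split=> x /=; rewrite !in_itv/=.
    by case=> x0 /andP[x0' _]; apply/eqP; rewrite eq_le x0.
  by move=> ->; rewrite !lexx ltW// two_pi_gt0.
by rewrite integral_set1.
Qed.

Lemma uniform_prob_gt2pi : P `]2 * pi, +oo[%classic = 0%E.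
Proof.
rewrite /uniform_prob integral_uniform_pdf.
have -> : `]2 * pi, +oo[%classic `&` `[0, 2 * pi] = set0 :> set R.
  apply/seteqP; split=> x //=; rewrite !in_itv/= andbT.
  by case=> x0 /andP[_]; rewrite leNgt x0.
by rewrite integral_set0.
Qed.

Lemma integrable_arc_length (f : circle R -> R) :
  m.-integrable setT (EFin \o f) -> P.-integrable setT (EFin \o (fun t => f (expi t))).
Proof.
move=> /integrableP[mf foo]; apply/integrableP; split.
  by apply: (measurableT_comp mf); exact: measurable_expi.
by move: foo; rewrite ge0_integral_distribution//; exact: measurableT_comp.
Qed.

Lemma Rintegral_arc_length (f : circle R -> R) :
  m.-integrable setT (EFin \o f) -> \int[m]_z f z = \int[P]_t f (expi t).
Proof.
move=> intf; rewrite /Rintegral integral_distribution//.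
  by case/integrableP : intf.
exact: integrable_arc_length.
Qed.

(** The limit is taken on the line under the uniform law of [[0, 2 pi]] and pushed forward by
    [expi]. Mass accumulating at [0] and mass accumulating at [2 * pi] are thereby reunited at the
    point 1. *)
Lemma circle_weak_limit (T : Type) (U : set_system T) (w : T -> circle R -> R) :
  UltraFilter U -> (forall x z, 0 <= w x z) ->
  (forall x, m.-integrable setT (EFin \o w x)) ->
  (forall x, \int[m]_z w x z <= 1) ->
  exists mu : {finite_measure set (circle R) -> \bar R},
  forall p, circle_test p ->
    \int[m]_z (p z * w x z) @[x --> U] --> \int[mu]_z p z.
Proof.
move=> UU w0 iw w1.
have [nu nuP] := @line_weak_limit R T U UU P _ (ltW (two_pi_gt0 R))
  uniform_prob_le0 uniform_prob_gt2pi (fun x t => w x (expi t))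
  (fun x t => w0 x _) (fun x => integrable_arc_length (iw x))
  (fun x => ltac:(by rewrite -Rintegral_arc_length)).
have mexpi := @measurable_expi R.
pose mu0 := pushforward nu (@expi R).
have fmu : fin_num_fun mu0.
  move=> A mA; rewrite /mu0/= /pushforward fin_num_measure//.
  by rewrite -[_ @^-1` _]setTI; exact: mexpi.
pose mu1 : {measure set (circle R) -> \bar R} := pushforward nu (@expi R).
pose mu : {finite_measure set (circle R) -> \bar R} :=
  HB.pack mu0 (Measure.on (mu1 mexpi)) (@Measure_isFinite.Build _ _ _ (mu1 mexpi) fmu).
exists (mu mexpi) => p [mp cp p1].
have -> : \int[mu mexpi]_z p z = \int[nu]_t p (expi t).
  rewrite /Rintegral [X in fine X](@integral_pushforward _ _ _ _ _ _ mexpi)//.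
    exact/measurable_EFinP.
  rewrite preimage_setT; apply: bounded_integrable => [|x]; last exact: p1.
  exact: measurableT_comp.
have -> : (fun x => \int[m]_z (p z * w x z)) =
    (fun x => \int[P]_t (p (expi t) * w x (expi t))).
  apply/funext => x; rewrite Rintegral_arc_length//.
  exact: integrableM_bounded (iw x).
by apply: nuP.
Qed.

End arc_length.

(** * Integration against signed measures *)

Section charge_integral.
Context (R : realType).
Notation m := (@arc_length R).
Variable nu : {charge set (circle R) -> \bar R}.

(** Writing [jp - jn] for the Jordan decomposition, [jp + mu2] and [jn + mu1] are the same positive
    measure. Integrating [g] against both and rearranging finite values gives the claim. *)
Lemma charge_integral_diff (mu1 mu2 : {finite_measure set (circle R) -> \bar R})
    (g : circle R -> R) (M : R) :
  (forall A, measurable A -> nu A = mu1 A - mu2 A)%E ->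
  measurable_fun setT g -> (forall z, `|g z| <= M) ->
  charge_integral nu g = \int[mu1]_z g z - \int[mu2]_z g z.
Proof.
move=> nuE mg gM; rewrite /charge_integral; case: cid => P exN; case: cid => N nuPN.
set jp := jordan_pos nuPN; set jn := jordan_neg nuPN.
have ip : jp.-integrable setT (EFin \o g) by exact: bounded_integrable gM.
have inn : jn.-integrable setT (EFin \o g) by exact: bounded_integrable gM.
have i1 : mu1.-integrable setT (EFin \o g) by exact: bounded_integrable gM.
have i2 : mu2.-integrable setT (EFin \o g) by exact: bounded_integrable gM.
have sumE : (\int[measure_add jp mu2]_z (g z)%:E =
    \int[measure_add jn mu1]_z (g z)%:E)%E.
  apply: eq_measure_integral => A mA _.
  transitivity (jp A + mu2 A)%E; first exact: measure_addE.
  transitivity (jn A + mu1 A)%E; last by rewrite -[RHS]/(measure_add jn mu1 A) measure_addE.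
  have := jordan_decomp nuPN mA; rewrite nuE// /cadd/= /cscale/= mulN1e.
  have : (jp A \is a fin_num)%E by rewrite fin_num_measure.
  have : (jn A \is a fin_num)%E by rewrite fin_num_measure.
  have : (mu1 A \is a fin_num)%E by rewrite fin_num_measure.
  have : (mu2 A \is a fin_num)%E by rewrite fin_num_measure.
  rewrite -/jp -/jn.
  case: (mu2 A) => // y _; case: (mu1 A) => // x _; case: (jn A) => // u _.
  case: (jp A) => // v _ => -[?]; congr (_%:E); lra.
move: sumE; rewrite !integral_measure_add//.
have := integrable_fin_num measurableT ip; have := integrable_fin_num measurableT inn.
have := integrable_fin_num measurableT i1; have := integrable_fin_num measurableT i2.
rewrite /Rintegral /=.
case: (\int[mu2]_z _)%E => // y _; case: (\int[mu1]_z _)%E => // x _.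
by case: (\int[jn]_z _)%E => // u _; case: (\int[jp]_z _)%E => // v _ [?] /=; lra.
Qed.

(** Both Jordan parts inherit absolute continuity, and [h] is the difference of their Radon-Nikodym
    derivatives. These are finite everywhere, so [fine] loses nothing. *)
Lemma charge_integral_density : nu `<< m ->
  exists2 h : circle R -> R, m.-integrable setT (EFin \o h) &
  forall (g : circle R -> R) (M : R), measurable_fun setT g -> (forall z, `|g z| <= M) ->
    charge_integral nu g = \int[m]_z (g z * h z).
Proof.
move=> num; rewrite /charge_integral; case: cid => P exN; case: cid => N nuPN.
set jp := jordan_pos nuPN; set jn := jordan_neg nuPN.
have jpm : jp `<< m by exact: jordan_pos_dominates.
have jnm : jn `<< m by exact: jordan_neg_dominates.
pose dp := Radon_Nikodym (charge_of_finite_measure jp) m.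
pose dn := Radon_Nikodym (charge_of_finite_measure jn) m.
have dpE z : dp z = (fine (dp z))%:E by rewrite fineK// Radon_Nikodym_fin_num.
have dnE z : dn z = (fine (dn z))%:E by rewrite fineK// Radon_Nikodym_fin_num.
have ip : m.-integrable setT (EFin \o (fine \o dp)).
  rewrite [X in integrable _ _ X](_ : _ = dp); first exact: Radon_Nikodym_integrable.
  by apply/funext => z; rewrite [RHS]dpE.
have inn : m.-integrable setT (EFin \o (fine \o dn)).
  rewrite [X in integrable _ _ X](_ : _ = dn); first exact: Radon_Nikodym_integrable.
  by apply/funext => z; rewrite [RHS]dnE.
exists (fun z => fine (dp z) - fine (dn z)).
  exact: (integrableB measurableT ip inn).
move=> g M mg gM.
have gip := integrableM_bounded mg gM ip.
have gin := integrableM_bounded mg gM inn.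
under [RHS]eq_Rintegral do rewrite mulrBr.
rewrite RintegralB//; congr (_ - _); rewrite /Rintegral; congr fine.
- rewrite -(Radon_Nikodym_change_of_variables jpm measurableT)//.
    by apply: eq_integral => z _; rewrite -/dp dpE EFinM.
  exact: bounded_integrable gM.
- rewrite -(Radon_Nikodym_change_of_variables jnm measurableT)//.
    by apply: eq_integral => z _; rewrite -/dn dnE EFinM.
  exact: bounded_integrable gM.
Qed.

End charge_integral.

(** * Test functions are norming for L^1 *)

Lemma Rintegral_dominated_cvg0 d (T : measurableType d) (R : realType)
    (mu : {measure set T -> \bar R}) (f : nat -> T -> R) (g : T -> R) :
  (forall n, measurable_fun setT (f n)) ->
  (forall x, f n x @[n --> \oo] --> 0) ->
  mu.-integrable setT (EFin \o g) -> (forall n x, `|f n x| <= g x) ->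
  \int[mu]_x f n x @[n --> \oo] --> 0.
Proof.
move=> mf f0 ig fg.
have [] := @dominated_convergence _ _ _ mu setT measurableT
  (fun n => EFin \o f n) (cst 0%E) (EFin \o g) _ _ _ ig.
- by move=> n; apply/measurable_EFinP; exact: mf.
- exact: measurable_cst.
- by apply: aeW => x _ /=; apply: cvg_EFin; [exact: nearW|exact: f0].
- by apply: aeW => x n _ /=; rewrite lee_fin.
by move=> _ _ /=; rewrite integral0; exact: fine_cvg.
Qed.

(** * Approximation in L^1 of a weighted measure *)

Section weighted_approximation.
Context d (T : measurableType d) (R : realType).
Variables (mu : {measure set T -> \bar R}) (w : T -> R).
Hypotheses (w0 : forall x, 0 <= w x) (iw : mu.-integrable setT (EFin \o w)).
Variable V : set (T -> R).
Hypotheses (mV : forall f, V f -> measurable_fun setT f)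
  (bV : forall f, V f -> exists M, forall x, `|f x| <= M)
  (VD : forall f g, V f -> V g -> V (fun x => f x + g x))
  (VZ : forall (q : rat) f, V f -> V (fun x => ratr q * f x)).

(** Membership of a bounded function in the closure of [V] for the weight [w]. Only rational
    multiples are assumed to stay in [V], so that a countable [V] is admissible. *)
Definition approximable (h : T -> R) : Prop :=
  [/\ measurable_fun setT h, exists M, forall x, `|h x| <= M &
      forall e, 0 < e -> exists2 f, V f & \int[mu]_x (`|h x - f x| * w x) < e].

Let integrable_dist (h f : T -> R) :
  measurable_fun setT h -> (exists M, forall x, `|h x| <= M) ->
  measurable_fun setT f -> (exists M, forall x, `|f x| <= M) ->
  mu.-integrable setT (EFin \o (fun x => `|h x - f x| * w x)).
Proof.
move=> mh [M hM] mf [N fN]; apply: (@integrableM_bounded _ _ _ _ _ _ (M + N)) => //.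
  by apply: measurableT_comp => //; exact: measurable_funB.
by move=> x; rewrite normr_id (le_trans (ler_normB _ _))// lerD.
Qed.

Let dist_triangle (h k f : T -> R) :
  measurable_fun setT h -> (exists M, forall x, `|h x| <= M) ->
  measurable_fun setT k -> (exists M, forall x, `|k x| <= M) ->
  measurable_fun setT f -> (exists M, forall x, `|f x| <= M) ->
  \int[mu]_x (`|h x - f x| * w x) <=
  \int[mu]_x (`|h x - k x| * w x) + \int[mu]_x (`|k x - f x| * w x).
Proof.
move=> mh bh mk bk mf bf.
have ihk := integrable_dist mh bh mk bk; have ikf := integrable_dist mk bk mf bf.
rewrite -RintegralD//; apply: le_Rintegral => //; first exact: integrable_dist.
  exact: (integrableD measurableT ihk ikf).
by move=> x _; rewrite -mulrDl ler_wpM2r// ler_distD.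
Qed.

(** Dominated convergence with majorant [(M + M) * w] brings some [h_ n] within [e / 2] of [h]; an
    element of [V] close to that [h_ n] does the rest. *)
Lemma approximable_lim (h_ : nat -> T -> R) (h : T -> R) (M : R) :
  (forall n, approximable (h_ n)) -> (forall n x, `|h_ n x| <= M) ->
  (forall x, h_ n x @[n --> \oo] --> h x) -> approximable h.
Proof.
move=> Ah hM hh.
have mh : measurable_fun setT h.
  apply: (@measurable_fun_cvg _ _ _ _ h_) => [n|x _]; last exact: hh.
  by have [] := Ah n.
have hbM x : `|h x| <= M.
  apply: (cvgr_to_le (f := fun n => `|h_ n x|) (cvg_norm (hh x))).
  by apply: nearW => n; exact: hM.
split=> //; first by exists M.
move=> e e0; have e2 : 0 < e / 2 by rewrite divr_gt0.
have /cvgrPdist_lt/(_ _ e2)[n _ /(_ n (leqnn n))] :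
    \int[mu]_x (`|h x - h_ n x| * w x) @[n --> \oo] --> 0.
  apply: (@Rintegral_dominated_cvg0 _ _ _ _ _ (fun x => (M + M) * w x)).
  - move=> n; have [mhn _ _] := Ah n.
    apply: measurable_funM; last by case/integrableP: iw => /measurable_EFinP.
    by apply: measurableT_comp => //; exact: measurable_funB.
  - move=> x; rewrite -(mul0r (w x)); apply: cvgMl.
    rewrite -(@normr0 _ R) -(subrr (h x)); apply: cvg_norm.
    by apply: cvgB => //; exact: cvg_cst.
  - exact: (integrableZl measurableT (M + M) iw).
  - move=> n x; rewrite normrM normr_id (ger0_norm (w0 x)) ler_wpM2r//.
    by rewrite (le_trans (ler_normB _ _))// lerD.
rewrite sub0r normrN ger0_norm => [hhn|]; last first.
  by apply: Rintegral_ge0 => x _; rewrite mulr_ge0.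
have [mhn bhn /(_ _ e2)[f Vf hf]] := Ah n.
exists f => //; rewrite [ltRHS]splitr.
apply: le_lt_trans (ltrD hhn hf); apply: dist_triangle => //.
- by exists M.
- exact: mV.
- exact: bV.
Qed.

Lemma approximableD (h k : T -> R) :
  approximable h -> approximable k -> approximable (fun x => h x + k x).
Proof.
move=> [mh bh Ah] [mk bk Ak].
have mhk : measurable_fun setT (fun x => h x + k x) by exact: measurable_funD.
have bhk : exists M, forall x, `|h x + k x| <= M.
  case: bh bk => M hM [N kN]; exists (M + N) => x.
  by rewrite (le_trans (ler_normD _ _))// lerD.
split=> // e e0; have e2 : 0 < e / 2 by rewrite divr_gt0.
have [f Vf hf] := Ah _ e2; have [g Vg kg] := Ak _ e2.
exists (fun x => f x + g x); first exact: VD.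
rewrite [ltRHS]splitr; apply: le_lt_trans (ltrD hf kg).
have ihf := integrable_dist mh bh (mV Vf) (bV Vf).
have ikg := integrable_dist mk bk (mV Vg) (bV Vg).
rewrite -RintegralD//.
have Vfg := VD Vf Vg.
apply: le_Rintegral => //.
- by apply: integrable_dist => //; [exact: mV|exact: bV].
- exact: (integrableD measurableT ihf ikg).
- by move=> x _; rewrite -mulrDl ler_wpM2r// opprD addrACA ler_normD.
Qed.

Lemma approximable_ratZ (q : rat) (h : T -> R) :
  approximable h -> approximable (fun x => ratr q * h x).
Proof.
move=> [mh bh Ah].
have mqh : measurable_fun setT (fun x => ratr q * h x) by exact: measurable_funM.
split=> //.
  case: bh => M hM; exists (`|ratr q| * M) => x.
  by rewrite normrM ler_wpM2l.
move=> e e0; pose c : R := `|ratr q| + 1.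
have c0 : 0 < c by rewrite ltr_wpDl.
have [f Vf hf] := Ah (e / c) (divr_gt0 e0 c0).
exists (fun x => ratr q * f x); first exact: VZ.
have ihf : mu.-integrable setT (EFin \o (fun x => `|h x - f x| * w x)).
  by apply: integrable_dist => //; [exact: mV|exact: bV].
under eq_Rintegral do rewrite -mulrBr normrM -mulrA.
rewrite RintegralZl//; move: hf; rewrite ltr_pdivlMr// => /(le_lt_trans _); apply.
rewrite mulrC ler_wpM2l//; last by rewrite lerDl.
by apply: Rintegral_ge0 => x _; rewrite mulr_ge0.
Qed.

(** A real multiple is a bounded pointwise limit of rational multiples, to which [approximable_lim]
    applies. *)
Lemma approximableZ (c : R) (h : T -> R) :
  approximable h -> approximable (fun x => c * h x).
Proof.
move=> Ah; have [mh [M hM] _] := Ah.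
have qP n : exists q : rat, `|c - ratr q| < n.+1%:R^-1.
  have : c - n.+1%:R^-1 < c + n.+1%:R^-1.
    by rewrite ltrBlDr -addrA ltrDl addr_gt0// invr_gt0.
  by move=> /rat_in_itvoo[q]; rewrite in_itv/= -ltr_distlC => ?; exists q.
pose q n := projT1 (cid (qP n)).
have qE n : `|c - ratr (q n)| < n.+1%:R^-1 by rewrite /q; case: cid.
have qc : ratr (q n) @[n --> \oo] --> c.
  apply/cvgrPdist_lt => e e0; near=> n.
  rewrite (lt_trans (qE n))//.
  by near: n; exact: near_infty_natSinv_lt (PosNum e0).
apply: (@approximable_lim (fun n x => ratr (q n) * h x) _ ((`|c| + 1) * `|M|)).
- by move=> n; exact: approximable_ratZ.
- move=> n x; rewrite normrM ler_pM// ?(le_trans (hM x)) ?ler_norm//.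
  rewrite -(subrK c (ratr _)) addrC (le_trans (ler_normD _ _))// lerD2l distrC.
  by rewrite (le_trans (ltW (qE n)))// invf_le1// ler1n.
- by move=> x; apply: cvgMl.
Unshelve. all: by end_near. Qed.

Lemma approximable_sum n (c : 'I_n -> R) (h : 'I_n -> T -> R) :
  approximable (cst 1) -> (forall i, approximable (h i)) ->
  approximable (fun x => \sum_(i < n) c i * h i x).
Proof.
move=> A1; elim: n c h => [|n IH] c h Ah.
  rewrite [X in approximable X](_ : _ = (fun x => 0 * cst 1 x)).
    exact: approximableZ.
  by apply/funext => x; rewrite big_ord0 mul0r.
rewrite [X in approximable X](_ : _ = (fun x =>
  (\sum_(i < n) c (widen_ord (leqnSn n) i) * h (widen_ord (leqnSn n) i) x) +
  c ord_max * h ord_max x)); last by apply/funext => x; rewrite big_ord_recr.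
by apply: approximableD; [exact: IH|exact: approximableZ].
Qed.

(** Dynkin's lemma: complements come from subtracting the indicator from 1, countable disjoint
    unions from bounded pointwise limits of finite sums. *)
Lemma approximable_indic (G : set (set T)) :
  @measurable _ T = <<s G>> -> setI_closed G -> approximable (cst 1) ->
  (forall A, G A -> approximable \1_A) ->
  forall A, measurable A -> approximable \1_A.
Proof.
move=> GE GI A1 AG A; rewrite GE => sA.
apply: (@dynkin_induction _ _ G (fun A => approximable \1_A) GE GI) sA => //.
- by rewrite indicT.
- move=> B mB AB.
  rewrite [X in approximable X](_ : _ = (fun x => cst 1 x + (- 1) * \1_B x)).
    by apply: approximableD => //; exact: approximableZ.
  apply/funext => x; rewrite indicC indicE /=.
  by case: (x \in B); rewrite /= ?mulr1 ?mulr0 ?subrr ?addr0.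
move=> F mF tF AF.
have FS n : \1_(\big[setU/set0]_(k < n) F k) =
    (fun x => \sum_(k < n) 1 * \1_(F k) x) :> (T -> R).
  elim: n => [|n IH].
    by apply/funext => x; rewrite !big_ord0 indic0.
  apply/funext => x; move/(congr1 (@^~ x)) : IH => /= IHx.
  rewrite !big_ord_recr/= -IHx mul1r !indicE in_setU.
  have [xF|//] := boolP (x \in F n); last by rewrite orbF addr0.
  rewrite orbT; case: (boolP (x \in _)) => [|_]; last by rewrite add0r.
  rewrite inE -bigcup_mkord => -[k /= kn Fkx].
  have := tF k n I I; rewrite inE in xF.
  move=> /(_ (ex_intro _ x (conj Fkx xF))) kEn.
  by rewrite kEn ltnn in kn.
apply: (@approximable_lim (fun n => \1_(\big[setU/set0]_(k < n) F k)) _ 1).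
- by move=> n; rewrite FS; apply: approximable_sum.
- by move=> n x; rewrite indicE ger0_norm// lern1 leq_b1.
- move=> x; have [[k _ Fkx]|nFx] := pselect ((\bigcup_k F k) x).
    apply: cvg_near_cst; exists k.+1 => // n /= kn.
    rewrite !indicE; congr (_ %:R); congr nat_of_bool.
    rewrite (mem_set (A := \bigcup_k F k)); last by exists k.
    by rewrite mem_set// -bigcup_mkord; exists k.
  apply: cvg_near_cst; apply: nearW => n.
  rewrite !indicE; congr (_ %:R); congr nat_of_bool.
  rewrite (memNset nFx) memNset// -bigcup_mkord => -[k _ Fkx].
  by apply: nFx; exists k.
Qed.

Import HBNNSimple.

(** Adding [M] makes [h] nonnegative, hence a limit of simple functions bounded by [M + M]; these
    are finite combinations of indicators. *)
Lemma approximable_bounded (G : set (set T)) :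
  @measurable _ T = <<s G>> -> setI_closed G -> approximable (cst 1) ->
  (forall A, G A -> approximable \1_A) ->
  forall (h : T -> R) (M : R), measurable_fun setT h -> (forall x, `|h x| <= M) ->
  approximable h.
Proof.
move=> GE GI A1 AG h M mh hM.
have hM0 x : 0 <= h x + M by move: (hM x); rewrite ler_norml => /andP[]; lra.
have mhM : measurable_fun setT (fun x => (h x + M)%:E).
  by apply/measurable_EFinP; exact: measurable_funD.
pose s n := nnsfun_approx measurableT mhM n.
have As n : approximable (s n).
  have /funext -> := fimfunEord (s n).
  by apply: approximable_sum => // i; exact: (approximable_indic GE).
have sle n x : s n x <= h x + M.
  rewrite -lee_fin /s nnsfun_approxE.
  by apply: (@le_approx _ _ _ setT) => // y _; rewrite lee_fin.
rewrite [X in approximable X](_ : h = (fun x => (h x + M) + (- M) * cst 1 x)).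
  apply: approximableD; last exact: approximableZ.
  apply: (@approximable_lim (fun n => s n) _ (M + M)) => //.
  - move=> n x; rewrite ger0_norm// (le_trans (sle n x))// lerD2r.
    exact: le_trans (ler_norm _) (hM x).
  - move=> x; have /= := @cvg_nnsfun_approx _ _ _ setT measurableT _ mhM
      (fun x _ => hM0 x) x I.
    by move/fine_cvg.
by apply/funext => x; rewrite mulr1 addrK.
Qed.

End weighted_approximation.

(** * Coordinates and a countable base of the circle *)

Section circle_coordinates.
Context (R : realType).
Implicit Types z : circle R.

(** Both signs are included so that strict lower bounds alone can cut out open rectangles. *)
Definition coordinate (b : bool * bool) z : R :=
  (-1) ^+ b.1 * (if b.2 then complex.Im (cval z) else complex.Re (cval z)).

Lemma coordinate_expi b (t : R) :
  coordinate b (expi t) = (-1) ^+ b.1 * (if b.2 then sin t else cos t).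
Proof. by rewrite /coordinate /cval /expi /expi_pt/=; case: b.2. Qed.

Lemma continuous_coordinate_expi b : continuous (fun t : R => coordinate b (expi t)).
Proof.
under [X in continuous X]eq_fun do rewrite coordinate_expi.
move=> t; apply: cvgMr; case: b.2; [exact: continuous_sin|exact: continuous_cos].
Qed.

Lemma sqr_norm_circle z :
  complex.Re (cval z) ^+ 2 + complex.Im (cval z) ^+ 2 = 1.
Proof.
have := valP z; rewrite inE /circle_set/= -[val z]/(cval z).
case: (cval z) => x y; rewrite normc_def/= => /(congr1 (@complex.Re R))/= xy1.
by rewrite -[LHS]sqr_sqrtr ?addr_ge0 ?sqr_ge0// xy1 expr1n.
Qed.

Lemma coordinate_le1 b z : `|coordinate b z| <= 1.
Proof.
rewrite /coordinate normrM normrX normrN1 expr1n mul1r.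
have := sqr_norm_circle z; case: (cval z) => x y /= xy1.
rewrite -sqrtr_sqr -sqrtr1 ler_wsqrtr//.
by case: b.2; have := sqr_ge0 x; have := sqr_ge0 y; lra.
Qed.

Lemma continuous_signed_Re_Im (b : bool * bool) :
  continuous (fun z : R[i]^o =>
    (-1) ^+ b.1 * (if b.2 then complex.Im z else complex.Re z) : R).
Proof.
move=> z; apply/(@cvgrPdist_lt R R _ (nbhs (z : R[i]^o)) (nbhs_filter (z : R[i]^o))) => e e0.
have ec : 0 < (e%:C)%C :> R[i] by rewrite ltcR.
apply/(@nbhs_ballP R[i] R[i]^o); exists (e%:C)%C => //= y; rewrite /ball/= normc_def ltcR.
rewrite -mulrBr normrM normrX normrN1 expr1n mul1r.
apply: le_lt_trans; case: z y => [u v] [c d] /=; case: b.2.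
  by rewrite -sqrtr_sqr ler_wsqrtr// lerDr sqr_ge0.
by rewrite -sqrtr_sqr ler_wsqrtr// lerDl sqr_ge0.
Qed.

Lemma open_coordinate_gt b (x : R) :
  open ([set z | x < coordinate b z] : set (circle_set R)).
Proof.
exists ((fun z : R[i]^o =>
    (-1) ^+ b.1 * (if b.2 then complex.Im z else complex.Re z) : R) @^-1` [set y | x < y]).
  by apply: open_comp; [move=> z _; exact: continuous_signed_Re_Im|exact: open_gt].
by [].
Qed.

Lemma measurable_coordinate b : measurable_fun setT (coordinate b).
Proof.
apply: (measurability _ (RGenOInfty.measurableE R)).
move=> _ [_ [x ->] <-]; rewrite setTI; apply: sub_sigma_algebra.
rewrite [X in open X](_ : _ = [set z | x < coordinate b z]).
  exact: open_coordinate_gt.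
by apply/seteqP; split=> z /=; rewrite in_itv/= andbT.
Qed.

(* A list of pairs (q, b) codes the open set where each coordinate b exceeds q;
   concatenation of codes is intersection. *)
Definition circle_cell (s : seq (rat * (bool * bool))) : set (circle R) :=
  [set z | all (fun p => ratr p.1 < coordinate p.2 z) s].

Definition circle_cells : set (set (circle R)) := range circle_cell.

Lemma circle_cells_setI : setI_closed circle_cells.
Proof.
move=> _ _ [s _ <-] [t _ <-]; exists (s ++ t) => //.
by apply/seteqP; split=> z /=; rewrite /circle_cell/= all_cat => /andP.
Qed.

Lemma open_circle_cell s : open (circle_cell s : set (circle_set R)).
Proof.
elim: s => [|[q b] s IH].
  by rewrite (_ : circle_cell _ = setT); [exact: openT|exact/seteqP].
rewrite (_ : circle_cell _ = [set z | ratr q < coordinate b z] `&` circle_cell s).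
  by apply: openI; [exact: open_coordinate_gt|].
by apply/seteqP; split=> z /=; rewrite /circle_cell/= => /andP.
Qed.

Lemma circle_cell_basis (U : set (circle_set R)) (z : circle_set R) :
  open U -> U z -> exists2 s, circle_cell s `<=` U & circle_cell s z.
Proof.
move=> [V oV <-] Vz; have := open_nbhs_nbhs (conj oV Vz).
move=> /nbhs_ballP[e /= e0 eV].
have [er ep] : (complex.Re e)%:C%C = e /\ 0 < complex.Re e.
  by case: e e0 {eV} => a b; rewrite ltcE /= => /andP[/eqP -> a0].
set r := complex.Re e in er ep.
(* A point exceeding all four thresholds is within [r / 2] of [z] in each coordinate, hence at
   distance less than [r], because twice [(r / 2) ^+ 2] is below [r ^+ 2]. *)
have rat_lt b : exists q : rat, coordinate b z - r / 2 < ratr q < coordinate b z.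
  have : coordinate b z - r / 2 < coordinate b z by rewrite ltrBlDr ltrDl divr_gt0.
  by move=> /rat_in_itvoo[q]; rewrite in_itv/= => ?; exists q.
pose q b := projT1 (cid (rat_lt b)).
have qP b : coordinate b z - r / 2 < ratr (q b) < coordinate b z.
  by rewrite /q; case: cid.
pose s := [seq (q b, b) | b <- [:: (false, false); (true, false); (false, true); (true, true)]].
exists s; last first.
  by rewrite /circle_cell /s /=; rewrite !(andP (qP _)).2.
move=> y; rewrite /circle_cell /s /= => /and5P[y1 y2 y3 y4 _].
apply: eV; rewrite /ball/= -er normc_def ltcR.
move: y1 y2 y3 y4 (qP (false, false)) (qP (true, false)) (qP (false, true)) (qP (true, true)).
rewrite /coordinate/= !expr1 !expr0 !mulN1r !mul1r /cval.
rewrite -![set_val _]/(val _).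
case: (val z) => a b; case: (val y) => c d /= y1 y2 y3 y4.
move=> /andP[? ?] /andP[? ?] /andP[? ?] /andP[? ?].
have ac : `|a - c| < r / 2 by rewrite ltr_norml; apply/andP; split; lra.
have bd : `|b - d| < r / 2 by rewrite ltr_norml; apply/andP; split; lra.
rewrite -(@ltr_pXn2r _ 2)// ?nnegrE ?sqrtr_ge0 ?(ltW ep)// sqr_sqrtr ?addr_ge0 ?sqr_ge0//.
have : `|a - c| ^+ 2 < (r / 2) ^+ 2 by rewrite ltr_pXn2r ?nnegrE// ltW// divr_gt0.
have : `|b - d| ^+ 2 < (r / 2) ^+ 2 by rewrite ltr_pXn2r ?nnegrE// ltW// divr_gt0.
by rewrite !real_normK ?num_real//; have := sqr_ge0 r; rewrite expr_div_n; lra.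
Qed.

(** Second countability: an open set is the union of the cells it contains, and the codes of cells
    form a countable type. Cells not contained in the open set are replaced by the empty set in that
    union. *)
Lemma measurable_circleE : @measurable _ (circle R) = <<s circle_cells>>.
Proof.
apply/seteqP; split; last first.
  apply: smallest_sub; first exact: sigma_algebra_measurable.
  by move=> _ [s _ <-]; apply: sub_sigma_algebra; exact: open_circle_cell.
apply: smallest_sub; first exact: smallest_sigma_algebra.
move=> U oU.
rewrite (_ : U = \bigcup_s (if `[<circle_cell s `<=` U>] then circle_cell s else set0)).
  pose T := g_sigma_algebraType circle_cells.
  apply: (@countable_bigcupT_measurable _ T); first exact: countableP.
  move=> s; case: ifPn => _; last exact: (@measurable0 _ T).
  by apply: sub_sigma_algebra; exists s.
apply/seteqP; split=> z /=.
  move=> Uz; have [s sU sz] := circle_cell_basis oU Uz.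
  by exists s => //; rewrite asboolT.
by case=> s _; case: asboolP => // sU; exact: sU.
Qed.

End circle_coordinates.

(** * A countable family of continuous functions on the circle *)

Section test_functions.
Context (R : realType).
Implicit Types (p q : circle R -> R) (z : circle R).

Definition circle_continuous p : Prop :=
  measurable_fun setT p /\ continuous (fun t : R => p (expi t)).

Lemma circle_continuous_cst (c : R) : circle_continuous (cst c).
Proof. by split=> // t; exact: cvg_cst. Qed.

Lemma circle_continuous_coordinate b : circle_continuous (coordinate b).
Proof. by split; [exact: measurable_coordinate|exact: continuous_coordinate_expi]. Qed.

Lemma circle_continuousD p q : circle_continuous p -> circle_continuous q ->
  circle_continuous (fun z => p z + q z).
Proof.
move=> [mp cp] [mq cq]; split; first exact: measurable_funD.
by move=> t; apply: cvgD; [exact: cp|exact: cq].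
Qed.

Lemma circle_continuousM p q : circle_continuous p -> circle_continuous q ->
  circle_continuous (fun z => p z * q z).
Proof.
move=> [mp cp] [mq cq]; split; first exact: measurable_funM.
by move=> t; apply: cvgM; [exact: cp|exact: cq].
Qed.

Lemma circle_continuous_comp (g : R -> R) p : continuous g ->
  circle_continuous p -> circle_continuous (fun z => g (p z)).
Proof.
move=> cg [mp cp]; split.
  by apply: (measurableT_comp _ mp); exact: continuous_measurable_fun.
by move=> t; apply: continuous_comp; [exact: cp|exact: cg].
Qed.

(** A continuous cutoff that converges pointwise to the indicator of the open half-line of positive
    reals; products of ramps then converge to indicators of cells. *)
Definition ramp (n : nat) (x : R) : R := Num.min 1 (Num.max 0 (n%:R * x)).

Lemma continuous_ramp n : continuous (ramp n).
Proof.
move=> x.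
have c : {for x, continuous (cst 0 \max ( *%R n%:R) : R -> R^o)}.
  by apply: continuous_max; [exact: cvg_cst|exact: mulrl_continuous].
have c' : {for x, continuous (cst 1 \min (cst 0 \max ( *%R n%:R)) : R -> R^o)}.
  by apply: continuous_min => //; exact: cvg_cst.
exact: c'.
Qed.

Lemma ramp_ge0 n x : 0 <= ramp n x.
Proof. by rewrite le_min ler01 le_max lexx. Qed.

Lemma ramp_le1 n x : ramp n x <= 1.
Proof. by rewrite ge_min lexx. Qed.

Lemma ramp_le0 n x : x <= 0 -> ramp n x = 0.
Proof.
move=> x0; rewrite /ramp max_l; first by rewrite min_r.
by rewrite mulr_ge0_le0.
Qed.

Lemma ramp_eq1 n x : 0 < x -> x^-1 <= n%:R -> ramp n x = 1.
Proof.
move=> x0; rewrite -(ler_pM2r x0) mulVf ?gt_eqF// => nx.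
by rewrite /ramp max_r ?min_l// (le_trans ler01).
Qed.

Definition cell_ramp n (s : seq (rat * (bool * bool))) z : R :=
  \prod_(c <- s) ramp n (coordinate c.2 z - ratr c.1).

Lemma circle_continuous_cell_ramp n s : circle_continuous (cell_ramp n s).
Proof.
elim: s => [|c s IH].
  rewrite (_ : cell_ramp _ _ = cst 1); first exact: circle_continuous_cst.
  by apply/funext => z; rewrite /cell_ramp big_nil.
rewrite (_ : cell_ramp _ _ = fun z => ramp n (coordinate c.2 z - ratr c.1) * cell_ramp n s z).
  apply: circle_continuousM => //; apply: circle_continuous_comp.
    exact: continuous_ramp.
  by apply: circle_continuousD; [exact: circle_continuous_coordinate|exact: circle_continuous_cst].
by apply/funext => z; rewrite /cell_ramp big_cons.
Qed.

Lemma cell_ramp_norm n s z : `|cell_ramp n s z| <= 1.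
Proof.
rewrite ger0_norm; first last.
  by apply: prodr_ge0 => c _; exact: ramp_ge0.
by apply: prodr_ile1 => c _; rewrite ramp_ge0 ramp_le1.
Qed.

Lemma cvg_cell_ramp s z :
  cell_ramp n s z @[n --> \oo] --> (\1_(circle_cell s) z : R).
Proof.
elim: s => [|c s IH].
  rewrite (_ : (fun n => _) = cst 1).
    rewrite indicE mem_set; first exact: cvg_cst.
    by rewrite /circle_cell/=.
  by apply/funext => n; rewrite /cell_ramp big_nil.
rewrite (_ : (fun n => _) =
  fun n => ramp n (coordinate c.2 z - ratr c.1) * cell_ramp n s z); last first.
  by apply/funext => n; rewrite /cell_ramp big_cons.
rewrite (_ : \1_(circle_cell (c :: s)) z =
    ((ratr c.1 < coordinate c.2 z)%R)%:R * \1_(circle_cell s) z :> R); last first.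
  rewrite !indicE -natrM mulnb; congr (_%:R); congr nat_of_bool.
  apply/idP/andP => [|[cz]]; first by rewrite inE => /andP[cz sz]; split=> //; rewrite inE.
  by rewrite 2!inE => sz; apply/andP.
apply: cvgM => //; have [cz|zc] := ltP.
  apply: cvg_near_cst; near=> n; apply: ramp_eq1; first by rewrite subr_gt0.
  by near: n; exact: nbhs_infty_ger.
apply: cvg_near_cst; apply: nearW => n.
by rewrite ramp_le0// subr_le0.
Unshelve. all: by end_near. Qed.

(** Built from rationals, naturals, booleans and lists only, hence a countable type: this is what
    later allows an enumeration of the test functions by [unpickle]. *)
Definition combination_code : Type := seq (rat * (nat * seq (rat * (bool * bool)))).

Definition combination (t : combination_code) z : R :=
  \sum_(c <- t) ratr c.1 * cell_ramp c.2.1 c.2.2 z.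

Lemma combination_cat t1 t2 z :
  combination (t1 ++ t2) z = combination t1 z + combination t2 z.
Proof. by rewrite /combination big_cat. Qed.

Lemma combination_scale (q : rat) t z :
  combination [seq (q * c.1, c.2) | c <- t] z = ratr q * combination t z.
Proof.
rewrite /combination big_map mulr_sumr; apply: eq_bigr => c _.
by rewrite rmorphM mulrA.
Qed.

Lemma circle_continuous_combination t : circle_continuous (combination t).
Proof.
elim: t => [|c t IH].
  rewrite (_ : combination _ = cst 0); first exact: circle_continuous_cst.
  by apply/funext => z; rewrite /combination big_nil.
rewrite (_ : combination _ = fun z => cst (ratr c.1) z * cell_ramp c.2.1 c.2.2 z + combination t z).
  apply: circle_continuousD => //; apply: circle_continuousM.
    exact: circle_continuous_cst.
  exact: circle_continuous_cell_ramp.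
by apply/funext => z; rewrite /combination big_cons.
Qed.

Lemma combination_bounded t : exists M, forall z, `|combination t z| <= M.
Proof.
exists (\sum_(c <- t) `|ratr c.1|) => z.
rewrite (le_trans (ler_norm_sum _ _ _))// ler_sum// => c _.
by rewrite normrM -[leRHS]mulr1 ler_wpM2l// cell_ramp_norm.
Qed.

Lemma approximable_combination (mu : {measure set (circle R) -> \bar R})
    (w h : circle R -> R) (M : R) :
  (forall z, 0 <= w z) -> mu.-integrable setT (EFin \o w) ->
  measurable_fun setT h -> (forall z, `|h z| <= M) ->
  forall e, 0 < e -> exists t,
    \int[mu]_z (`|h z - combination t z| * w z) < e.
Proof.
move=> w0 iw mh hM e e0.
pose V := range combination.
have mV f : V f -> measurable_fun setT f.
  by case=> t _ <-; case: (circle_continuous_combination t).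
have bV f : V f -> exists M, forall x, `|f x| <= M.
  by case=> t _ <-; exact: combination_bounded.
have VD f g : V f -> V g -> V (fun x => f x + g x).
  move=> [s _ <-] [t _ <-]; exists (s ++ t) => //.
  by apply/funext => z; exact: combination_cat.
have VZ (q : rat) f : V f -> V (fun x => ratr q * f x).
  move=> [t _ <-]; exists [seq (q * c.1, c.2) | c <- t] => //.
  by apply/funext => z; exact: combination_scale.
have AV f : V f -> approximable mu w V f.
  move=> Vf; split; [exact: mV|exact: bV|move=> r r0; exists f => //].
  under eq_Rintegral do rewrite subrr normr0 mul0r.
  by rewrite Rintegral_cst// mul0r.
have cell_V n s : V (cell_ramp n s).
  exists [:: (1, (n, s))] => //; apply/funext => z.
  by rewrite /combination big_cons big_nil addr0 rmorph1 mul1r.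
have A1 : approximable mu w V (cst 1).
  rewrite (_ : cst 1 = cell_ramp 0 [::]); first exact/AV/cell_V.
  by apply/funext => z; rewrite /cell_ramp big_nil.
have AG A : circle_cells A -> approximable mu w V (\1_A).
  move=> [s _ <-].
  apply: (approximable_lim w0 iw mV bV (h_ := fun n => cell_ramp n s) (M := 1)).
  - by move=> n; exact/AV/cell_V.
  - by move=> n z; exact: cell_ramp_norm.
  - by move=> z; exact: cvg_cell_ramp.
have [_ _ /(_ _ e0)[_ [t _ <-] ht]] := approximable_bounded w0 iw mV bV VD VZ
  (measurable_circleE R) (@circle_cells_setI R) A1 AG mh hM.
by exists t.
Qed.

End test_functions.

(** The real part of the radial projection of [a + i b] onto the closed unit disc; its imaginary
    part is [disc_proj b a]. *)
Definition disc_proj (R : realType) (a b : R) : R :=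
  a / Num.max 1 (Num.sqrt (a ^+ 2 + b ^+ 2)).

Section disc_proj.
Context (R : realType).
Implicit Types a b h k : R.

Let r a b := Num.sqrt (a ^+ 2 + b ^+ 2).

Let r_ge a b : `|a| <= r a b.
Proof. by rewrite -sqrtr_sqr ler_wsqrtr// lerDl sqr_ge0. Qed.

Let rC a b : r a b = r b a. Proof. by rewrite /r addrC. Qed.

Let sqr_r a b : r a b ^+ 2 = a ^+ 2 + b ^+ 2.
Proof. by rewrite sqr_sqrtr// addr_ge0 ?sqr_ge0. Qed.

Lemma disc_proj_sqr_le1 a b : disc_proj a b ^+ 2 + disc_proj b a ^+ 2 <= 1.
Proof.
rewrite /disc_proj -/(r a b) -/(r b a) (rC b a) !exprMn -mulrDl -sqr_r -exprMn.
have m1 : 1 <= Num.max 1 (r a b) by rewrite le_max lexx.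
rewrite exprn_ile1// ?mulr_ge0 ?sqrtr_ge0 ?invr_ge0 ?(le_trans ler01)//.
by rewrite ler_pdivrMr ?(lt_le_trans ltr01)// mul1r le_max lexx orbT.
Qed.

(** The projection moves [a] by at most the excess of the modulus of [(a, b)] over 1, and this
    excess is at most the distance from [(a, b)] to any point [(h, k)] of the disc. *)
Lemma disc_proj_dist h k a b : h ^+ 2 + k ^+ 2 <= 1 ->
  `|h - disc_proj a b| <= `|h - a| + (`|h - a| + `|k - b|).
Proof.
move=> hk; have -> : h - disc_proj a b = (h - a) + (a - disc_proj a b) by ring.
rewrite (le_trans (ler_normD _ _))// lerD2l//.
rewrite /disc_proj -/(r a b); have [r1|r1] := leP (r a b) 1.
  by rewrite divr1 subrr normr0 addr_ge0.
have r0 : 0 < r a b by apply: lt_trans r1.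
apply: (@le_trans _ _ (r a b - 1)).
  have -> : a - a / r a b = a * (r a b - 1) / r a b by field; rewrite gt_eqF.
  rewrite normrM normfV (gtr0_norm r0) ler_pdivrMr// normrM mulrC.
  by rewrite (@gtr0_norm _ (r a b - 1)) ?subr_gt0// ler_wpM2l// subr_ge0 ltW.
rewrite lerBlDr; set d1 := `|h - a|; set d2 := `|k - b|.
have d10 : 0 <= d1 := normr_ge0 _; have d20 : 0 <= d2 := normr_ge0 _.
rewrite -(@ler_pXn2r _ 2)// ?nnegrE ?(ltW r0) ?addr_ge0// sqr_r.
have ha : `|a - h| = d1 by rewrite distrC.
have kb : `|b - k| = d2 by rewrite distrC.
have d1s : d1 ^+ 2 = (a - h) ^+ 2 by rewrite -ha real_normK ?num_real.
have d2s : d2 ^+ 2 = (b - k) ^+ 2 by rewrite -kb real_normK ?num_real.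
have h1 : `|h| <= 1 by rewrite -sqrtr_sqr -sqrtr1 ler_wsqrtr//; have := sqr_ge0 k; lra.
have k1 : `|k| <= 1 by rewrite -sqrtr_sqr -sqrtr1 ler_wsqrtr//; have := sqr_ge0 h; lra.
have hd : h * (a - h) <= d1.
  rewrite (le_trans (ler_norm _))// normrM ha -[leRHS]mul1r ler_wpM2r//.
have kd : k * (b - k) <= d2.
  rewrite (le_trans (ler_norm _))// normrM kb -[leRHS]mul1r ler_wpM2r//.
have dd : 0 <= d1 * d2 by exact: mulr_ge0.
have -> : a ^+ 2 + b ^+ 2 = (h ^+ 2 + k ^+ 2) + 2 * (h * (a - h) + k * (b - k))
   + ((a - h) ^+ 2 + (b - k) ^+ 2) by ring.
rewrite -d1s -d2s.
have -> : (d1 + d2 + 1) ^+ 2 = d1 ^+ 2 + d2 ^+ 2 + 1 + 2 * (d1 * d2) + 2 * (d1 + d2) by ring.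
lra.
Qed.

Lemma continuous_inv_max1 : continuous (fun x : R => (Num.max 1 x)^-1).
Proof.
move=> x; have c : {for x, continuous (cst 1 \max id : R -> R^o)}.
  by apply: continuous_max; [exact: cvg_cst|exact: cvg_id].
have n0 : (cst 1 \max id : R -> R^o) x != 0.
  by rewrite gt_eqF//= lt_max ltr01.
exact: (continuousV n0 c).
Qed.

End disc_proj.

(** * The L^1 norm as a supremum over test functions *)

Section dual_norm.
Context (R : realType).
Notation m := (@arc_length R).
Implicit Types f : circle R -> R[i].

Definition pairing (phi f : circle R -> R[i]) : R :=
  \int[m]_z complex.Re (phi z * f z).

(** Projecting restores the bound 1, which an approximating combination may violate, while keeping
    continuity and the countable index set. *)
Definition disc_test (c : combination_code * combination_code) (z : circle R) : R[i] :=
  (disc_proj (combination c.1 z) (combination c.2 z) +i*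
   disc_proj (combination c.2 z) (combination c.1 z))%C.

Let circle_continuous_disc_proj (p q : circle R -> R) :
  circle_continuous p -> circle_continuous q ->
  circle_continuous (fun z => disc_proj (p z) (q z)).
Proof.
move=> cp cq; apply: circle_continuousM => //.
apply: (circle_continuous_comp (g := fun x => (Num.max 1 x)^-1)).
  exact: continuous_inv_max1.
apply: circle_continuous_comp; first exact: sqrt_continuous.
by apply: circle_continuousD; under eq_fun do rewrite expr2;
  exact: circle_continuousM.
Qed.

Let disc_proj_le1 (a b : R) : `|disc_proj a b| <= 1.
Proof.
rewrite -sqrtr_sqr -sqrtr1 ler_wsqrtr//.
by have := disc_proj_sqr_le1 a b; have := sqr_ge0 (disc_proj b a); lra.
Qed.

Lemma circle_test_Re_disc_test c : circle_test (fun z => complex.Re (disc_test c z)).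
Proof.
have [] := circle_continuous_disc_proj (circle_continuous_combination R c.1)
  (circle_continuous_combination R c.2).
by split=> // z; exact: disc_proj_le1.
Qed.

Lemma circle_test_Im_disc_test c : circle_test (fun z => complex.Im (disc_test c z)).
Proof.
have [] := circle_continuous_disc_proj (circle_continuous_combination R c.2)
  (circle_continuous_combination R c.1).
by split=> // z; exact: disc_proj_le1.
Qed.

Lemma normc_disc_test c z : Normc.normc (disc_test c z) <= 1.
Proof. by rewrite /= -sqrtr1 ler_wsqrtr// disc_proj_sqr_le1. Qed.

Lemma integrable_normc f : L1 f -> m.-integrable setT (EFin \o (fun z => Normc.normc (f z))).
Proof.
move=> [i1 i2].
have m1 : measurable_fun setT (fun z => complex.Re (f z)).
  by case/integrableP : i1 => /measurable_EFinP.
have m2 : measurable_fun setT (fun z => complex.Im (f z)).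
  by case/integrableP : i2 => /measurable_EFinP.
have i12 := integrableD measurableT (integrable_norm i1) (integrable_norm i2).
apply: (le_integrable measurableT _ _ i12).
  apply/measurable_EFinP.
  rewrite (_ : (fun z => _) = Num.sqrt \o
    (fun z => complex.Re (f z) ^+ 2 + complex.Im (f z) ^+ 2)); last first.
    by apply/funext => z /=; case: (f z).
  apply: measurableT_comp.
    by apply: continuous_measurable_fun; exact: sqrt_continuous.
  by apply: measurable_funD; exact: measurable_funX.
move=> z _ /=; rewrite lee_fin; case: (f z) => a b /=.
rewrite (ger0_norm (sqrtr_ge0 _)) (ger0_norm (addr_ge0 (normr_ge0 a) (normr_ge0 b))).
rewrite -(@ler_pXn2r _ 2)// ?nnegrE ?sqrtr_ge0 ?addr_ge0//.
rewrite sqr_sqrtr ?addr_ge0 ?sqr_ge0// sqrrD !real_normK ?num_real//.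
by rewrite addrAC lerDl mulrn_wge0// mulr_ge0.
Qed.

(* Approximate the conjugate phase of f for the weight |f|. *)
Lemma le_norm1_pairing f (M : R) : L1 f ->
  (forall c, pairing (disc_test c) f <= M) -> norm1 f <= M.
Proof.
move=> L1f fM; have [i1 i2] := L1f.
pose f1 z := complex.Re (f z); pose f2 z := complex.Im (f z).
pose w z := Normc.normc (f z).
have iw : m.-integrable setT (EFin \o w) := integrable_normc L1f.
have w0 z : 0 <= w z by rewrite /w; case: (f z) => a b; exact: sqrtr_ge0.
have mw : measurable_fun setT w by case/integrableP : iw => /measurable_EFinP.
have m1 : measurable_fun setT f1 by case/integrableP : i1 => /measurable_EFinP.
have m2 : measurable_fun setT f2 by case/integrableP : i2 => /measurable_EFinP.
have w2 z : w z ^+ 2 = f1 z ^+ 2 + f2 z ^+ 2.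
  by rewrite /w /f1 /f2; case: (f z) => a b; rewrite sqr_sqrtr// addr_ge0 ?sqr_ge0.
have mVw : measurable_fun setT (fun z => (w z)^-1).
  under eq_fun do rewrite -powR_inv1//.
  by apply: (measurableT_comp (f := @powR R ^~ (-1))) => //; exact: measurable_powR.
(* [h1 + i h2] is the conjugate of [f] divided by its modulus; at zeros of [f] the convention that 0
   is its own inverse makes it 0. *)
pose h1 z := f1 z * (w z)^-1; pose h2 z := - f2 z * (w z)^-1.
have h12 z : h1 z ^+ 2 + h2 z ^+ 2 <= 1.
  have [wz|wz] := eqVneq (w z) 0; first by rewrite /h1 /h2 wz invr0 !mulr0 expr0n/= addr0.
  by rewrite /h1 /h2 !exprMn sqrrN -mulrDl -w2 -exprMn mulfV// expr1n.
have mh1 : measurable_fun setT h1 by exact: measurable_funM.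
have mh2 : measurable_fun setT h2.
  by apply: measurable_funM => //; exact: measurableT_comp.
have h1w z : h1 z * f1 z - h2 z * f2 z = w z.
  rewrite /h1 /h2; have [wz|wz] := eqVneq (w z) 0; first by rewrite wz invr0 !mulr0 !mul0r subr0.
  transitivity ((f1 z ^+ 2 + f2 z ^+ 2) * (w z)^-1); first by ring.
  by rewrite -w2 expr2 mulfK.
have h1le z : `|h1 z| <= 1.
  by rewrite -sqrtr_sqr -sqrtr1 ler_wsqrtr//; have := h12 z; have := sqr_ge0 (h2 z); lra.
have h2le z : `|h2 z| <= 1.
  by rewrite -sqrtr_sqr -sqrtr1 ler_wsqrtr//; have := h12 z; have := sqr_ge0 (h1 z); lra.
(* Using [disc_proj_dist] for both coordinates costs at most [3 * (d1 + d2)]; two errors of [e / 6]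
   then add up to [e]. *)
apply/ler_addgt0Pl => e e0; have e6 : 0 < e / 6 by rewrite divr_gt0.
have [t1 ht1] := approximable_combination w0 iw mh1 h1le e6.
have [t2 ht2] := approximable_combination w0 iw mh2 h2le e6.
have /= := fM (t1, t2); rewrite /pairing.
set A := \int[m]_z _ => AM.
pose d1 z := `|h1 z - combination t1 z| * w z.
pose d2 z := `|h2 z - combination t2 z| * w z.
have id (h : circle R -> R) t : measurable_fun setT h -> (forall z, `|h z| <= 1) ->
    m.-integrable setT (EFin \o (fun z => `|h z - combination t z| * w z)).
  move=> mh hle; have [N tN] := @combination_bounded R t.
  apply: (@integrableM_bounded _ _ _ _ _ _ (1 + N)) => //.
    apply: measurableT_comp => //; apply: measurable_funB => //.
    by case: (circle_continuous_combination R t).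
  by move=> z; rewrite normr_id (le_trans (ler_normB _ _))// lerD.
have id1 : m.-integrable setT (EFin \o d1) := id _ _ mh1 h1le.
have id2 : m.-integrable setT (EFin \o d2) := id _ _ mh2 h2le.
pose c := (t1, t2).
have [mc1 _ c1] := circle_test_Re_disc_test c.
have [mc2 _ c2] := circle_test_Im_disc_test c.
have iA : m.-integrable setT (EFin \o (fun z => complex.Re (disc_test c z * f z))).
  have := integrableB measurableT (integrableM_bounded mc1 c1 i1)
     (integrableM_bounded mc2 c2 i2).
  congr integrable; apply/funext => z /=.
  by case: (f z) => a b; rewrite /= -EFinB.
have id12 := integrableD measurableT id1 id2.
have i3d : m.-integrable setT (EFin \o (fun z => 3 * (d1 z + d2 z))).
  exact: (integrableZl measurableT 3 id12).
have : norm1 f <= A + 3 * (\int[m]_z d1 z + \int[m]_z d2 z).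
  rewrite -RintegralD// -RintegralZl// /A -RintegralD//.
  apply: le_Rintegral => //.
    exact: (integrableD measurableT iA i3d).
  move=> z _; rewrite -/(w z).
  have -> : complex.Re (disc_test c z * f z) =
      disc_proj (combination t1 z) (combination t2 z) * f1 z -
      disc_proj (combination t2 z) (combination t1 z) * f2 z.
    by rewrite /f1 /f2; case: (f z).
  have fw1 : `|f1 z| <= w z.
    by rewrite -sqrtr_sqr -(ger0_norm (w0 z)) -sqrtr_sqr ler_wsqrtr// w2 lerDl sqr_ge0.
  have fw2 : `|f2 z| <= w z.
    by rewrite -sqrtr_sqr -(ger0_norm (w0 z)) -sqrtr_sqr ler_wsqrtr// w2 lerDr sqr_ge0.
  rewrite -lerBlDl -[X in X - _]h1w.
  set p1 := disc_proj _ _; set p2 := disc_proj _ _.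
  have D1 := disc_proj_dist (combination t1 z) (combination t2 z) (h12 z).
  have h21 : h2 z ^+ 2 + h1 z ^+ 2 <= 1 by rewrite addrC.
  have D2 := disc_proj_dist (combination t2 z) (combination t1 z) h21.
  apply: (@le_trans _ _ (`|h1 z - p1| * w z + `|h2 z - p2| * w z)).
    have -> : h1 z * f1 z - h2 z * f2 z - (p1 * f1 z - p2 * f2 z) =
       (h1 z - p1) * f1 z + (h2 z - p2) * (- f2 z) by ring.
    rewrite lerD// (le_trans (ler_norm _))// normrM ?normrN ler_wpM2l//.
  rewrite /d1 /d2 -!mulrDl mulrA ler_wpM2r//.
  rewrite -/p1 -/p2 in D1 D2; lra.
rewrite -/d1 -/d2 in ht1 ht2.
move=> /le_trans; apply; lra.
Qed.

End dual_norm.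

(** * Extreme points for Riesz sets *)

(* The maximizer of sum_n 2^-n a_n^2, a strictly convex function of the
   coordinates (a_n), is not a proper midpoint: this replaces Krein-Milman. *)
Lemma exists_not_midpoint (R : realType) (T : Type) (a : nat -> T -> R) (x0 : T) :
  (forall n x, `|a n x| <= 1) ->
  (forall (U : set_system nat) (x : nat -> T), UltraFilter U ->
    exists y, forall n, a n (x k) @[k --> U] --> a n y) ->
  exists y, forall u v, (forall n, a n y = (a n u + a n v) / 2) ->
    forall n, a n u = a n v.
Proof.
move=> a1 compactT.
(* Partial sums stand for the series: estimates carry the tail [2 * 2^-1 ^+ N], and [N] is chosen
   large only at the end. The supremum [S] runs over all [N] and all points. *)
pose Phi N x := \sum_(i < N) 2^-1 ^+ i * a i x ^+ 2.
have half0 i : 0 < (2^-1 : R) ^+ i by rewrite exprn_gt0// invr_gt0.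
have a2 i x : a i x ^+ 2 <= 1.
  by rewrite -[X in X <= _]real_normK ?num_real// exprn_ile1.
have geo N : \sum_(i < N) 2^-1 ^+ i + 2 * 2^-1 ^+ N = 2 :> R.
  elim: N => [|N IH]; first by rewrite big_ord0 add0r expr0 mulr1.
  by rewrite big_ord_recr/= -[RHS]IH exprS; field.
have tail N N' x : Phi N' x <= Phi N x + 2 * 2^-1 ^+ N.
  have term0 i : 0 <= 2^-1 ^+ i * a i x ^+ 2 :> R.
    by rewrite mulr_ge0 ?sqr_ge0// ltW.
  have [NN'|/ltnW N'N] := leqP N N'; last first.
    rewrite ler_wpDr ?mulr_ge0 ?(ltW (half0 _))//.
    rewrite -(subnKC N'N) /Phi big_split_ord/= lerDl.
    by apply: sumr_ge0.
  rewrite -(subnKC NN') /Phi big_split_ord/= lerD2l.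
  apply: (@le_trans _ _ (\sum_(i < N' - N) 2^-1 ^+ N * 2^-1 ^+ i)).
    apply: ler_sum => i _; rewrite -exprD -[leRHS]mulr1.
    by apply: ler_wpM2l; [exact: ltW|exact: a2].
  rewrite -mulr_sumr mulrC ler_wpM2r ?(ltW (half0 _))//.
  by rewrite -[leRHS](geo (N' - N)%N) lerDl mulr_ge0// ltW.
pose E := [set r | exists N x, r = Phi N x].
have supE : has_sup E.
  split; first by exists (Phi 0%N x0), 0%N, x0.
  exists 2 => _ [N [x ->]]; have := tail 0%N N x.
  by rewrite /Phi big_ord0 add0r expr0 mulr1.
pose S := sup E.
have PhiS N x : Phi N x <= S by apply: ub_le_sup; [case: supE|exists N, x].
have near_max k : exists x, exists N, S - 2^-1 ^+ k < Phi N x.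
  have [_ [N [x ->]] ?] := sup_adherent (half0 k) supE.
  by exists x, N.
pose x k := projT1 (cid (near_max k)).
have xP k : exists N, S - 2^-1 ^+ k < Phi N (x k) by rewrite /x; case: cid.
(* Since [U] refines the filter at infinity, the defect [2^-1 ^+ k] of the maximizing sequence is
   negligible along [U]. *)
have [U [UU Uoo]] := @ultraFilterLemma _ \oo eventually_filter.
have [y ay] := compactT U x UU.
have Phiy N : S - 2 * 2^-1 ^+ N <= Phi N y.
  have cPhi : Phi N (x k) @[k --> U] --> Phi N y.
    apply: cvg_big => [|i _]; first exact: add_continuous.
    by apply: cvgMr; under eq_fun do rewrite expr2; apply: cvgM; exact: ay.
  apply/ler_addgt0Pr => e e0; rewrite -lerBlDr.
  have UF : ProperFilter U := @ultra_proper _ _ UU.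
  apply: (cvgr_to_ge cPhi); apply: Uoo.
  have : 2^-1 ^+ k @[k --> \oo] --> (0 : R).
    by apply: cvg_expr; rewrite ger0_norm ?invr_ge0// invf_lt1// ltr1n.
  move=> /cvgrPdist_lt/(_ _ e0); apply: filterS => k.
  rewrite sub0r normrN gtr0_norm// => ke.
  by have [N' SN'] := xP k; have := tail N N' (x k); lra.
exists y => u v yuv n; apply/eqP; rewrite -subr_eq0 -sqrf_eq0.
rewrite eq_le sqr_ge0 andbT leNgt; apply/negP => d0.
pose d N := \sum_(i < N) 2^-1 ^+ i * (a i u - a i v) ^+ 2.
have parallelogram N : Phi N u + Phi N v = 2 * Phi N y + d N / 2.
  rewrite /Phi /d mulr_sumr mulr_suml -!big_split/=; apply: eq_bigr => i _.
  by rewrite yuv; field.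
(* By the parallelogram law [d N / 2] is at most [2 * S - 2 * (S - 2 * 2^-1 ^+ N)], that is
   [4 * 2^-1 ^+ N]. *)
have dle N : d N <= 8 * 2^-1 ^+ N.
  have := parallelogram N; have := PhiS N u; have := PhiS N v; have := Phiy N; lra.
have dn N : (n < N)%N -> 2^-1 ^+ n * (a n u - a n v) ^+ 2 <= d N.
  move=> nN; rewrite /d (bigD1 (Ordinal nN))//= lerDl.
  by apply: sumr_ge0 => i _; rewrite mulr_ge0 ?sqr_ge0// ltW.
have : 2^-1 ^+ k @[k --> \oo] --> (0 : R).
  by apply: cvg_expr; rewrite ger0_norm ?invr_ge0// invf_lt1// ltr1n.
set q := 2^-1 ^+ n * (a n u - a n v) ^+ 2 in dn.
have q0 : 0 < q / 8 by rewrite divr_gt0// mulr_gt0.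
move=> /cvgrPdist_lt/(_ _ q0)[K _ KP].
have := KP (maxn K n.+1) (leq_maxl _ _); rewrite sub0r normrN gtr0_norm//.
have := dle (maxn K n.+1); have := dn _ (leq_maxr K n.+1); lra.
Qed.

(** * Characters as test functions, and signed weak limits *)

Section pairing_theory.
Context (R : realType).
Notation m := (@arc_length R).
Implicit Types (f g : circle R -> R[i]) (z : circle R).

Definition complex_test (phi : circle R -> R[i]) : Prop :=
  circle_test (fun z => complex.Re (phi z)) /\
  circle_test (fun z => complex.Im (phi z)).

Lemma conjc_circleV z : ((cval z)^*%C)^-1 = cval z :> R[i].
Proof.
have z1 : cval z * (cval z)^*%C = 1.
  have := sqr_norm_circle z; case: (cval z) => x y /= xy.
  by rewrite -[LHS]/((_ +i* _)%C) mulrN opprK -!expr2 xy mulrN mulrC addNr.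
have z0 : (cval z)^*%C != 0.
  by apply/eqP => z0; move/eqP: z1; rewrite z0 mulr0 eq_sym oner_eq0.
by apply: (mulIf z0); rewrite mulVf// z1.
Qed.

Lemma normc_circle z : Normc.normc (cval z) = 1.
Proof. by have := sqr_norm_circle z; case: (cval z) => x y /= ->; rewrite sqrtr1. Qed.

(** On the circle the inverse is the conjugate, so integer powers become natural powers, accessible
    to induction. *)
Lemma conj_powE (k : int) z :
  conj_pow k z = match k with Posz n => (cval z)^*%C ^+ n | Negz n => cval z ^+ n.+1 end.
Proof. by case: k => n; rewrite /conj_pow// NegzE -exprnN -exprVn conjc_circleV. Qed.

Let circle_continuousX (phi : circle R -> R[i]) n :
  circle_continuous (fun z => complex.Re (phi z)) ->
  circle_continuous (fun z => complex.Im (phi z)) ->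
  circle_continuous (fun z => complex.Re (phi z ^+ n)) /\
  circle_continuous (fun z => complex.Im (phi z ^+ n)).
Proof.
move=> c1 c2; elim: n => [|n [IH1 IH2]].
  by split; rewrite /=; [exact: (circle_continuous_cst (1 : R))|exact: (circle_continuous_cst (0 : R))].
split.
  rewrite (_ : (fun z => _) = fun z => complex.Re (phi z) * complex.Re (phi z ^+ n) +
    cst (-1) z * (complex.Im (phi z) * complex.Im (phi z ^+ n))).
    by do ! [apply: circle_continuousD|apply: circle_continuousM|apply: circle_continuous_cst|].
  by apply/funext => z; rewrite exprS mulN1r; case: (phi z) (phi z ^+ n) => [a b] [c d].
rewrite (_ : (fun z => _) = fun z => complex.Re (phi z) * complex.Im (phi z ^+ n) +
    complex.Im (phi z) * complex.Re (phi z ^+ n)).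
  by do ! [apply: circle_continuousD|apply: circle_continuousM|].
by apply/funext => z; rewrite exprS; case: (phi z) (phi z ^+ n) => [a b] [c d].
Qed.

Let circle_continuous_conj_pow k :
  circle_continuous (fun z => complex.Re (conj_pow k z)) /\
  circle_continuous (fun z => complex.Im (conj_pow k z)).
Proof.
have cRe : circle_continuous (fun z => complex.Re (cval z)).
  have := circle_continuous_coordinate R (false, false).
  by congr circle_continuous; apply/funext => z; rewrite /coordinate expr0 mul1r.
have cIm : circle_continuous (fun z => complex.Im (cval z)).
  have := circle_continuous_coordinate R (false, true).
  by congr circle_continuous; apply/funext => z; rewrite /coordinate expr0 mul1r.
have cImN : circle_continuous (fun z => - complex.Im (cval z)).
  have := circle_continuous_coordinate R (true, true).
  by congr circle_continuous; apply/funext => z; rewrite /coordinate expr1 mulN1r.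
have E : conj_pow k = fun z => match k with Posz n => (cval z)^*%C ^+ n | Negz n => cval z ^+ n.+1 end.
  by apply/funext => z; exact: conj_powE.
rewrite E; case: k {E} => n; apply: circle_continuousX => //.
  by rewrite (_ : (fun z => _) = fun z => complex.Re (cval z))//; apply/funext => z; case: (cval z).
by rewrite (_ : (fun z => _) = fun z => - complex.Im (cval z))//; apply/funext => z; case: (cval z).
Qed.

Lemma normc_conj_pow k z : Normc.normc (conj_pow k z) = 1.
Proof.
have X (x : R[i]) n : Normc.normc x = 1 -> Normc.normc (x ^+ n) = 1.
  move=> x1; elim: n => [|n IH]; first by rewrite expr0 Normc.normc1.
  by rewrite exprS Normc.normcM x1 mul1r.
rewrite conj_powE; case: k => n; apply: X; last exact: normc_circle.
by rewrite -[RHS](normc_circle z); case: (cval z) => a b /=; rewrite sqrrN.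
Qed.

Lemma Re_le_normc (x : R[i]) : `|complex.Re x| <= Normc.normc x.
Proof. by case: x => a b /=; rewrite -sqrtr_sqr ler_wsqrtr// lerDl sqr_ge0. Qed.

Lemma Im_le_normc (x : R[i]) : `|complex.Im x| <= Normc.normc x.
Proof. by case: x => a b /=; rewrite -sqrtr_sqr ler_wsqrtr// lerDr sqr_ge0. Qed.

Lemma complex_test_conj_pow k : complex_test (conj_pow k).
Proof.
have [[m1 c1] [m2 c2]] := circle_continuous_conj_pow k.
by split; split=> // z; rewrite -(normc_conj_pow k z) ?Re_le_normc ?Im_le_normc.
Qed.

Lemma complex_test_disc_test c : complex_test (disc_test c).
Proof. by split; [exact: circle_test_Re_disc_test|exact: circle_test_Im_disc_test]. Qed.

Lemma integrable_Re_testM phi f : complex_test phi -> L1 f ->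
  m.-integrable setT (EFin \o (fun z => complex.Re (phi z * f z))).
Proof.
move=> [[m1 _ b1] [m2 _ b2]] [i1 i2].
have := integrableB measurableT (integrableM_bounded m1 b1 i1) (integrableM_bounded m2 b2 i2).
by congr integrable; apply/funext => z /=; case: (phi z) (f z) => [a b] [c d]; rewrite /= -EFinB.
Qed.

Lemma integrable_Im_testM phi f : complex_test phi -> L1 f ->
  m.-integrable setT (EFin \o (fun z => complex.Im (phi z * f z))).
Proof.
move=> [[m1 _ b1] [m2 _ b2]] [i1 i2].
have := integrableD measurableT (integrableM_bounded m1 b1 i2) (integrableM_bounded m2 b2 i1).
by congr integrable; apply/funext => z /=; case: (phi z) (f z) => [a b] [c d]; rewrite /= -EFinD.
Qed.

Lemma L1_testM phi f : complex_test phi -> L1 f -> L1 (fun z => phi z * f z).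
Proof. by move=> tphi L1f; split; [exact: integrable_Re_testM|exact: integrable_Im_testM]. Qed.

Lemma Re_cintegral_testM phi f : complex_test phi -> L1 f ->
  complex.Re (cintegral m (fun z => phi z * f z)) =
  \int[m]_z (complex.Re (phi z) * complex.Re (f z)) -
  \int[m]_z (complex.Im (phi z) * complex.Im (f z)).
Proof.
move=> [[m1 _ b1] [m2 _ b2]] [i1 i2] /=.
rewrite -RintegralB//; [|exact: integrableM_bounded i1|exact: integrableM_bounded i2].
by apply: eq_Rintegral => z _; case: (phi z) (f z) => [a b] [c d].
Qed.

Lemma Im_cintegral_testM phi f : complex_test phi -> L1 f ->
  complex.Im (cintegral m (fun z => phi z * f z)) =
  \int[m]_z (complex.Re (phi z) * complex.Im (f z)) +
  \int[m]_z (complex.Im (phi z) * complex.Re (f z)).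
Proof.
move=> [[m1 _ b1] [m2 _ b2]] [i1 i2] /=.
rewrite -RintegralD//; [|exact: integrableM_bounded i2|exact: integrableM_bounded i1].
by apply: eq_Rintegral => z _; case: (phi z) (f z) => [a b] [c d].
Qed.

Lemma pairing_le_norm1 phi f : complex_test phi -> L1 f ->
  (forall z, Normc.normc (phi z) <= 1) -> `|pairing phi f| <= norm1 f.
Proof.
move=> tphi L1f phi1; have i := integrable_Re_testM tphi L1f.
apply: (le_trans (le_normr_Rintegral measurableT i)).
apply: le_Rintegral => //; [exact: integrable_norm i|exact: integrable_normc|].
move=> z _; rewrite (le_trans (Re_le_normc _))// Normc.normcM -[leRHS]mul1r ler_wpM2r//.
by case: (f z) => a b; exact: sqrtr_ge0.
Qed.

Lemma pairingD phi f g (c : R) : complex_test phi -> L1 f -> L1 g ->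
  pairing phi (fun z => f z + c%:C%C * g z) = pairing phi f + c * pairing phi g.
Proof.
move=> tphi L1f L1g; rewrite /pairing -RintegralZl//; last exact: integrable_Re_testM.
rewrite -RintegralD//; [|exact: integrable_Re_testM|].
  apply: eq_Rintegral => z _; case: (phi z) (f z) (g z) => [a b] [p q] [r s] /=.
  by rewrite !mul0r subr0 addr0; ring.
exact: (integrableZl measurableT c (integrable_Re_testM tphi L1g)).
Qed.

(** Positive and negative parts are passed to the limit separately. Their limits may overlap, so the
    difference need not be a Jordan decomposition; [charge_integral_diff] bridges the gap. *)
Lemma signed_weak_limit (T : Type) (U : set_system T) (g : T -> circle R -> R) :
  UltraFilter U -> (forall x, m.-integrable setT (EFin \o g x)) ->
  (forall x, \int[m]_z `|g x z| <= 1) ->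
  exists nu : {charge set (circle R) -> \bar R}, forall p, circle_test p ->
    \int[m]_z (p z * g x z) @[x --> U] --> charge_integral nu p.
Proof.
move=> UU ig g1.
have ip x := integrable_funrpos measurableT (ig x).
have iN x := integrable_funrneg measurableT (ig x).
have sub1 (h : T -> circle R -> R) : (forall x z, 0 <= h x z <= `|g x z|) ->
    (forall x, m.-integrable setT (EFin \o h x)) -> forall x, \int[m]_z h x z <= 1.
  move=> h01 ih x; apply: le_trans (g1 x); apply: le_Rintegral => //.
    exact: integrable_norm.
  by move=> z _; case/andP: (h01 x z).
have pos01 x z : 0 <= (g x)^\+ z <= `|g x z|.
  by rewrite funrpos_ge0/= ge_max ler_norm normr_ge0.
have neg01 x z : 0 <= (g x)^\- z <= `|g x z|.
  by rewrite funrneg_ge0/= ge_max normr_ge0 -normrN ler_norm.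
have [mu1 lim1] := circle_weak_limit UU (fun x z => funrpos_ge0 (g x) z) ip
  (sub1 (fun x => (g x)^\+) pos01 ip).
have [mu2 lim2] := circle_weak_limit UU (fun x z => funrneg_ge0 (g x) z) iN
  (sub1 (fun x => (g x)^\-) neg01 iN).
exists (cadd (charge_of_finite_measure mu1) (cscale (-1) (charge_of_finite_measure mu2))).
move=> p tp; have [mp _ p1] := tp.
rewrite (@charge_integral_diff _ _ mu1 mu2 p 1)//; last first.
  by move=> A mA; rewrite -[LHS]/(mu1 A + (-1)%:E * mu2 A)%E EFinN mulN1e.
rewrite (_ : (fun x => _) = fun x => \int[m]_z (p z * (g x)^\+ z) - \int[m]_z (p z * (g x)^\- z)).
  by apply: cvgB; [exact: lim1|exact: lim2].
apply/funext => x; rewrite -RintegralB//; [|exact: integrableM_bounded (ip x)|exact: integrableM_bounded (iN x)].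
apply: eq_Rintegral => z _; rewrite -mulrBr; congr (_ * _).
by rewrite -[in LHS](funrposBneg (g x)).
Qed.

End pairing_theory.

(** * Compactness of the ball and an extreme point *)

Section riesz_set.
Context (R : realType).
Notation m := (@arc_length R).
Variable L : set int.
Implicit Types (f g : circle R -> R[i]) (z : circle R).

Lemma riesz_ball_limit (T : Type) (U : set_system T) (F : T -> circle R -> R[i]) :
  Riesz_set R L -> UltraFilter U -> (forall x, unit_ball L (F x)) ->
  exists2 g, unit_ball L g & forall phi, complex_test phi ->
    pairing phi (F x) @[x --> U] --> pairing phi g.
Proof.
move=> rieszL UU BF.
have UF : ProperFilter U := @ultra_proper _ _ UU.
have L1F x : L1 (F x) by have [[]] := BF x.
have F1 x : norm1 (F x) <= 1 by have [] := BF x.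
have specF x k : ~ L k -> fourier (F x) k = 0.
  have [[_ sF] _] := BF x; move=> nLk; apply/eqP/negP => /negP nz.
  exact/nLk/sF.
have [nu1 lim1] := signed_weak_limit UU (fun x => (L1F x).1)
  (fun x => le_trans (le_Rintegral measurableT (integrable_norm (L1F x).1)
     (integrable_normc (L1F x)) (fun z _ => Re_le_normc (F x z))) (F1 x)).
have [nu2 lim2] := signed_weak_limit UU (fun x => (L1F x).2)
  (fun x => le_trans (le_Rintegral measurableT (integrable_norm (L1F x).2)
     (integrable_normc (L1F x)) (fun z _ => Im_le_normc (F x z))) (F1 x)).
pose rho := ComplexMeasure nu1 nu2.
have cvgRe phi : complex_test phi ->
    complex.Re (cintegral m (fun z => phi z * F x z)) @[x --> U] -->
    complex.Re (cm_integral rho phi).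
  move=> tphi; have [t1 t2] := tphi.
  rewrite (_ : (fun x => _) = fun x =>
    \int[m]_z (complex.Re (phi z) * complex.Re (F x z)) -
    \int[m]_z (complex.Im (phi z) * complex.Im (F x z))).
    by apply: cvgB; [exact: lim1|exact: lim2].
  by apply/funext => x; rewrite Re_cintegral_testM.
have cvgIm phi : complex_test phi ->
    complex.Im (cintegral m (fun z => phi z * F x z)) @[x --> U] -->
    complex.Im (cm_integral rho phi).
  move=> tphi; have [t1 t2] := tphi.
  rewrite (_ : (fun x => _) = fun x =>
    \int[m]_z (complex.Im (phi z) * complex.Re (F x z)) +
    \int[m]_z (complex.Re (phi z) * complex.Im (F x z))).
    by apply: cvgD; [exact: lim1|exact: lim2].
  by apply/funext => x; rewrite Im_cintegral_testM// addrC.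
have lim0 (u : T -> R) (l : R) : u @ U --> l -> (forall x, u x = 0) -> l = 0.
  move=> ul u0; rewrite (_ : u = cst 0) in ul; last exact/funext.
  by apply: (cvg_unique (@Rhausdorff R) ul); exact: cvg_cst.
(* Characters are themselves test functions, so a Fourier coefficient that vanishes for every [F x]
   also vanishes for the limit measure. *)
have spec_rho k : ~ L k -> cm_integral rho (conj_pow k) = 0.
  move=> nLk; have tk := complex_test_conj_pow R k.
  have := lim0 _ _ (cvgRe _ tk) (fun x => congr1 (@complex.Re R) (specF x k nLk)).
  have := lim0 _ _ (cvgIm _ tk) (fun x => congr1 (@complex.Im R) (specF x k nLk)).
  by case: (cm_integral _ _) => a b /= -> ->.
have [ac1 ac2] : abs_continuous rho.
  apply: rieszL => k /=; rewrite /spec_measure/= => nz; apply: contrapT => nLk.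
  by move: nz; rewrite /fourier_measure spec_rho// eqxx.
have [h1 ih1 nu1E] := charge_integral_density ac1.
have [h2 ih2 nu2E] := charge_integral_density ac2.
pose g z := (h1 z +i* h2 z)%C.
have L1g : L1 g by split.
have gE phi : complex_test phi -> cintegral m (fun z => phi z * g z) = cm_integral rho phi.
  move=> tphi; have [[m1 _ b1] [m2 _ b2]] := tphi.
  apply/eqP; rewrite eq_complex Re_cintegral_testM// Im_cintegral_testM//=.
  by rewrite (nu1E _ _ m1 b1) (nu1E _ _ m2 b2) (nu2E _ _ m1 b1) (nu2E _ _ m2 b2) eqxx/= addrC eqxx.
have cvgg phi : complex_test phi -> pairing phi (F x) @[x --> U] --> pairing phi g.
  by move=> tphi; rewrite -[pairing phi g]/(complex.Re (cintegral m (fun z => phi z * g z)))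
    gE//; exact: cvgRe.
exists g => //; split; first split=> //.
  move=> k; rewrite /spec/= => nz; apply: contrapT => nLk; move: nz.
  by rewrite /fourier gE ?spec_rho ?eqxx//; exact: complex_test_conj_pow.
apply: le_norm1_pairing => // c.
have := cvgg _ (complex_test_disc_test R c); move/cvgr_to_le; apply.
apply: (@filterS _ U _ setT); last exact: filterT.
move=> x _; apply: le_trans (F1 x); apply: le_trans (ler_norm _) _.
by apply: pairing_le_norm1 => //; [exact: complex_test_disc_test|exact: normc_disc_test].
Qed.

(** All pairings of the difference are 0, so [le_norm1_pairing] bounds its norm by 0. *)
Lemma ae_eq_pairing f g : L1 f -> L1 g ->
  (forall c, pairing (disc_test c) f = pairing (disc_test c) g) -> ae_eq m setT f g.
Proof.
move=> L1f L1g fg.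
pose d z := f z + (-1)%:C%C * g z.
have dE z : d z = f z - g z.
  by rewrite /d rmorphN rmorph1 mulN1r.
have L1d : L1 d.
  split.
    have := integrableB measurableT L1f.1 L1g.1; congr integrable; apply/funext => z /=.
    by rewrite dE; case: (f z) (g z) => [a b] [p q]; rewrite /= -EFinB.
  have := integrableB measurableT L1f.2 L1g.2; congr integrable; apply/funext => z /=.
  by rewrite dE; case: (f z) (g z) => [a b] [p q]; rewrite /= -EFinB.
have d0 : norm1 d <= 0.
  apply: le_norm1_pairing => // c.
  rewrite pairingD//; last exact: complex_test_disc_test.
  by rewrite fg mulN1r subrr.
have id := integrable_normc L1d.
have id0 : (\int[m]_z `|(Normc.normc (d z))%:E| = 0)%E.
  rewrite (_ : (fun z => _) = fun z => (Normc.normc (d z))%:E).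
    apply/eqP; rewrite eq_le -[X in (X <= _)%E]fineK ?lee_fin ?integrable_fin_num//.
    by rewrite d0/= integral_ge0// => z _; rewrite lee_fin; case: (d z) => a b; exact: sqrtr_ge0.
  apply/funext => z; rewrite gee0_abs// lee_fin; case: (d z) => a b; exact: sqrtr_ge0.
have md : measurable_fun setT (fun z => (Normc.normc (d z))%:E) by case/integrableP: id.
have /(ae_eq_integral_abs m measurableT md) := id0.
apply: filterS => z /= /(_ I) [/Normc.eq0_normc]; rewrite dE => /eqP.
by rewrite subr_eq0 => /eqP fgz _.
Qed.

Lemma pairing_midpoint phi f u v : complex_test phi -> L1 f -> L1 u -> L1 v ->
  ae_eq m setT f (fun z => 2^-1 * (u z + v z)) ->
  pairing phi f = (pairing phi u + pairing phi v) / 2.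
Proof.
move=> tphi L1f L1u L1v fuv.
have iu := integrable_Re_testM tphi L1u; have iv := integrable_Re_testM tphi L1v.
have iuv := integrableD measurableT iu iv.
have half z : complex.Re (phi z * (2^-1 * (u z + v z))) =
    2^-1 * (complex.Re (phi z * u z) + complex.Re (phi z * v z)).
  have -> : 2^-1 = (2^-1 : R)%:C%C :> R[i] by rewrite fmorphV rmorph_nat.
  case: (phi z) (u z) (v z) => [a b] [p q] [r s] /=.
  by rewrite !mul0r subr0 addr0; ring.
rewrite mulrC /pairing -RintegralD// -RintegralZl//; congr fine.
apply: ae_eq_integral => //.
- by case/integrableP: (integrable_Re_testM tphi L1f).
- by case/integrableP: (integrableZl measurableT 2^-1 iuv).
- by apply: filterS fuv => z /= /(_ I) -> _; rewrite half.
Qed.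

Lemma riesz_extreme_point : Riesz_set R L ->
  exists f : circle R -> R[i], extreme_point (unit_ball L) f.
Proof.
move=> rieszL.
(* Functions rather than classes: equality of all coordinates is turned into equality almost
   everywhere by [ae_eq_pairing]. *)
pose T := {f : circle R -> R[i] | unit_ball L f}.
have B0 : unit_ball L (fun=> 0 : R[i]).
  have c0 k : fourier (fun=> 0 : R[i]) k = 0 :> R[i].
    rewrite /fourier /cintegral; under eq_Rintegral do rewrite mulr0/=.
    under [X in (_ +i* X)%C]eq_Rintegral do rewrite mulr0/=.
    by rewrite !Rintegral_cst// !mul0r.
  split; first split.
  - by split; rewrite /=; exact: (finite_measure_integrable_cst m 0 measurableT).
  - by move=> k; rewrite /spec/= c0 eqxx.
  - rewrite /norm1; under eq_Rintegral do rewrite Normc.normc0.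
    by rewrite Rintegral_cst// mul0r ler01.
(* A natural number that codes no test function contributes the coordinate 0, for which every
   condition is trivial. *)
pose a n (x : T) : R :=
  if @unpickle (combination_code * combination_code)%type n is Some c
  then pairing (disc_test c) (sval x) else 0.
have a1 n (x : T) : `|a n x| <= 1.
  rewrite /a; case: unpickle => [c|]; last by rewrite normr0.
  case: x => f [[L1f _] f1] /=; apply: le_trans f1; apply: pairing_le_norm1 => //.
    exact: complex_test_disc_test.
  exact: normc_disc_test.
have [[f Bf] fP] : exists y, forall u v, (forall n, a n y = (a n u + a n v) / 2) ->
    forall n, a n u = a n v.
  apply: (exists_not_midpoint (exist _ _ B0)) => // U x UU.
  have [g Bg gP] := @riesz_ball_limit _ U (fun k => sval (x k)) rieszL UU (fun k => svalP (x k)).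
  exists (exist _ g Bg) => n; rewrite /a; case: unpickle => [c|]; last exact: cvg_cst.
  exact/gP/complex_test_disc_test.
exists f; split=> // -[u [v [Bu Bv uv fuv]]].
have [[[L1u _] _] [[L1v _] _]] := (Bu, Bv); have [[L1f _] _] := Bf.
apply: uv; apply: ae_eq_pairing => // c.
have := fP (exist _ u Bu) (exist _ v Bv) _ (pickle c).
rewrite /a pickleK /=; apply=> n; rewrite /a; case: unpickle => [{}c|]; last by rewrite addr0 mul0r.
by apply: pairing_midpoint => //; exact: complex_test_disc_test.
Qed.

End riesz_set.

(** * Perturbations and absence of extreme points *)

Section perturbation.
Context (R : realType).
Notation m := (@arc_length R).
Implicit Types (f g : circle R -> R[i]) (h : circle R -> R) (z : circle R) (L : set int).

Lemma cintegralD f g : L1 f -> L1 g ->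
  cintegral m (fun z => f z + g z) = cintegral m f + cintegral m g.
Proof.
move=> [f1 f2] [g1 g2]; rewrite /cintegral -[RHS]/((_ + _) +i* (_ + _))%C.
rewrite -!RintegralD//; congr (_ +i* _)%C;
  by apply: eq_Rintegral => z _; case: (f z) (g z) => [a b] [c d].
Qed.

Lemma cintegralZ (c : R[i]) f : L1 f -> cintegral m (fun z => c * f z) = c * cintegral m f.
Proof.
move=> [f1 f2]; case: c => a b; rewrite /cintegral.
rewrite -[RHS]/((_ - _) +i* (_ + _))%C -!RintegralZl//.
have iZ (e : R) (p : circle R -> R) : m.-integrable setT (EFin \o p) ->
    m.-integrable setT (EFin \o (fun z => e * p z)).
  by move=> ip; exact: (integrableZl measurableT e ip).
rewrite -RintegralB//; [|exact: iZ..]; rewrite -RintegralD//; [|exact: iZ..].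
by congr (_ +i* _)%C; apply: eq_Rintegral => z _; case: (f z).
Qed.

Lemma L1D f g : L1 f -> L1 g -> L1 (fun z => f z + g z).
Proof.
move=> [f1 f2] [g1 g2]; split.
  have := integrableD measurableT f1 g1; congr integrable; apply/funext => z /=.
  by case: (f z) (g z) => [a b] [c d].
have := integrableD measurableT f2 g2; congr integrable; apply/funext => z /=.
by case: (f z) (g z) => [a b] [c d].
Qed.

Lemma L1_realM h f : measurable_fun setT h -> (forall z, `|h z| <= 1) ->
  L1 f -> L1 (fun z => (h z)%:C%C * f z).
Proof.
move=> mh h1 [f1 f2]; split.
  have := integrableM_bounded mh h1 f1; congr integrable; apply/funext => z /=.
  by case: (f z) => a b /=; rewrite mul0r subr0.
have := integrableM_bounded mh h1 f2; congr integrable; apply/funext => z /=.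
by case: (f z) => a b /=; rewrite mul0r addr0.
Qed.

Lemma L1Z (c : R[i]) f : L1 f -> L1 (fun z => c * f z).
Proof.
have iZ (e : R) (p : circle R -> R) : m.-integrable setT (EFin \o p) ->
    m.-integrable setT (EFin \o (fun z => e * p z)).
  by move=> ip; exact: (integrableZl measurableT e ip).
move=> [f1 f2]; case: c => a b; split.
  have := integrableB measurableT (iZ a _ f1) (iZ b _ f2); congr integrable.
  by apply/funext => z /=; case: (f z).
have := integrableD measurableT (iZ a _ f2) (iZ b _ f1); congr integrable.
by apply/funext => z /=; case: (f z).
Qed.

Lemma fourierD f g k : L1 f -> L1 g ->
  fourier (fun z => f z + g z) k = fourier f k + fourier g k.
Proof.
move=> L1f L1g; have tk := complex_test_conj_pow R k.
rewrite /fourier -cintegralD; [|exact: L1_testM..].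
by congr cintegral; apply/funext => z; rewrite mulrDr.
Qed.

Lemma fourierZ (c : R[i]) f k : L1 f -> fourier (fun z => c * f z) k = c * fourier f k.
Proof.
move=> L1f; have tk := complex_test_conj_pow R k.
rewrite /fourier -cintegralZ; last exact: L1_testM.
by congr cintegral; apply/funext => z; rewrite mulrCA.
Qed.

Lemma L1_specP L f : L1_spec L f <-> L1 f /\ forall k, ~ L k -> fourier f k = 0.
Proof.
split=> -[L1f sf]; split=> // k.
  by move=> nLk; apply/eqP/negP => /negP nz; exact/nLk/sf.
by rewrite /spec/= => nz; apply: contrapT => /sf /eqP; rewrite (negbTE nz).
Qed.

Lemma L1_specD L f g : L1_spec L f -> L1_spec L g -> L1_spec L (fun z => f z + g z).
Proof.
move=> /L1_specP[L1f sf] /L1_specP[L1g sg]; apply/L1_specP; split; first exact: L1D.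
by move=> k nLk; rewrite fourierD// sf// sg// addr0.
Qed.

Lemma L1_specZ L (c : R[i]) f : L1_spec L f -> L1_spec L (fun z => c * f z).
Proof.
move=> /L1_specP[L1f sf]; apply/L1_specP; split; first exact: L1Z.
by move=> k nLk; rewrite fourierZ// sf// mulr0.
Qed.

Lemma normc_realM (a : R) (x : R[i]) : Normc.normc (a%:C%C * x) = `|a| * Normc.normc x.
Proof. by rewrite Normc.normcM /= expr0n/= addr0 sqrtr_sqr. Qed.

(* Since 1 + h and 1 - h are nonnegative, the moduli of f (1 + h) and f (1 - h)
   integrate to the norm of f plus or minus the integral of |f| h. *)
Lemma perturbation_not_extreme L f h :
  measurable_fun setT h -> (forall z, `|h z| <= 1) ->
  (L1 f -> L1_spec L (fun z => (h z)%:C%C * f z)) ->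
  \int[m]_z (h z * Normc.normc (f z)) = 0 ->
  ~ ae_eq m setT (fun z => (h z)%:C%C * f z) (fun=> 0) ->
  ~ extreme_point (unit_ball L) f.
Proof.
move=> mh h1 sh fh0 fhN0 [[Lf f1]]; apply.
have [L1f _] := Lf.
pose u z := f z + (h z)%:C%C * f z; pose v z := f z + (-1) * ((h z)%:C%C * f z).
have Lu : L1_spec L u by apply: L1_specD => //; exact: sh.
have Lv : L1_spec L v.
  by apply: L1_specD => //; apply: (@L1_specZ L (-1)); exact: sh.
have ifn := integrable_normc L1f.
have ihf := integrableM_bounded mh h1 ifn.
have hle z : -1 <= h z <= 1 by rewrite -ler_norml.
exists u, v; split.
- split=> //; suff -> : norm1 u = norm1 f by [].
  rewrite -[RHS]addr0 -fh0 -RintegralD//; apply: eq_Rintegral => z _.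
  rewrite -[X in Normc.normc X]/(f z + (h z)%:C%C * f z).
  rewrite -[X in X + _]mul1r -mulrDl -(rmorph1 (real_complex R)) -rmorphD/=.
  rewrite normc_realM ger0_norm; last by have /andP[? ?] := hle z; lra.
  by rewrite mulrDl mul1r.
- split=> //; suff -> : norm1 v = norm1 f by [].
  rewrite -[RHS]subr0 -fh0 -RintegralB//; apply: eq_Rintegral => z _.
  rewrite -[X in Normc.normc X]/(f z + (-1) * ((h z)%:C%C * f z)).
  rewrite mulN1r -[X in X - _]mul1r -mulrBl -(rmorph1 (real_complex R)) -rmorphB/=.
  rewrite normc_realM ger0_norm; last by have /andP[? ?] := hle z; lra.
  by rewrite mulrBl mul1r.
- move=> uv; apply: fhN0; apply: filterS uv => z /= /(_ I) + _.
  rewrite /u /v mulN1r => /addrI /eqP; rewrite -addr_eq0 -mulr2n mulrn_eq0/=.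
  by move/eqP.
- apply: aeW => z _; rewrite /u /v mulN1r addrACA subrr addr0 -mulr2n.
  by rewrite -[f z *+ 2]mulr_natl mulKf// pnatr_eq0.
Qed.

Lemma norm1_eq0_ae f : L1 f -> norm1 f = 0 -> ae_eq m setT f (fun=> 0).
Proof.
move=> L1f f0; have L10 : L1 (fun=> 0 : R[i]).
  by split; rewrite /=; exact: (finite_measure_integrable_cst m 0 measurableT).
apply: ae_eq_pairing => // c; have tc := complex_test_disc_test R c.
have := pairing_le_norm1 tc L1f (@normc_disc_test R c).
rewrite f0 normr_le0 => /eqP ->.
by rewrite /pairing; under eq_Rintegral do rewrite mulr0/=; rewrite Rintegral_cst// mul0r.
Qed.

End perturbation.

(** * Orthogonality of characters *)

Section orthogonality.
Context (R : realType).
Notation m := (@arc_length R).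
Notation P := (uniform_prob (@two_pi_gt0 R)).
Implicit Types (z : circle R).

(** Nonnegativity is what [integral_uniform] asks for. Sines and cosines are made to fit by adding
    1, whose integral is then subtracted. *)
Lemma uniform_integral_FTC (F g : R -> R) :
  (forall t : R, is_derive t (1 : R) F (g t)) -> continuous g -> (forall t, 0 <= g t) ->
  \int[P]_t g t = (F (2 * pi) - F 0) / (2 * pi).
Proof.
move=> dF cg g0; rewrite /Rintegral integral_uniform/=; [|
  by apply/measurable_EFinP; exact: continuous_measurable_fun|
  by move=> t; rewrite lee_fin].
have cF : continuous F.
  by move=> t; apply: differentiable_continuous; apply/derivable1_diffP; have [] := dF t.
rewrite (@continuous_FTC2 _ g F)//.
- by rewrite -EFinD -EFinM/= subr0 mulrC.
- exact: two_pi_gt0.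
- exact: continuous_subspaceT.
- split; first by move=> t _; have [] := dF t.
  + by apply: cvg_at_right_filter; exact: cF.
  + by apply: cvg_at_left_filter; exact: cF.
- by move=> t _; rewrite derive1E; have [] := dF t.
Qed.

Lemma cos_nat_2pi n : cos (n%:R * (2 * pi)) = 1 :> R.
Proof.
elim: n => [|n IH]; first by rewrite mul0r cos0.
by rewrite -natr1 mulrDl mul1r [X in _ + X]mulr_natl cosD2pi.
Qed.

Lemma sin_nat_2pi n : sin (n%:R * (2 * pi)) = 0 :> R.
Proof.
elim: n => [|n IH]; first by rewrite mul0r sin0.
by rewrite -natr1 mulrDl mul1r [X in _ + X]mulr_natl sinD2pi.
Qed.

Let is_derive_mull (c t : R) : is_derive t (1 : R) ( *%R c) c.
Proof.
have := is_deriveZ c (is_derive_id t (1 : R)).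
by move/is_derive_eq; apply; rewrite /GRing.scale/= mulr1.
Qed.

Let integrable_cos_sin n : P.-integrable setT (EFin \o (fun t => cos (n%:R * t))) /\
  P.-integrable setT (EFin \o (fun t => sin (n%:R * t))).
Proof.
have c : continuous ( *%R (n%:R : R)) by exact: mulrl_continuous.
split; apply: (@bounded_integrable _ _ _ P _ 1).
- apply: continuous_measurable_fun => t.
  by apply: continuous_comp; [exact: c|exact: continuous_cos].
- by move=> t; rewrite ler_norml cos_geN1 cos_le1.
- apply: continuous_measurable_fun => t.
  by apply: continuous_comp; [exact: c|exact: continuous_sin].
- by move=> t; rewrite ler_norml sin_geN1 sin_le1.
Qed.

Let P1 : \int[P]_t (cst 1 t) = 1 :> R.
Proof. by rewrite Rintegral_cst// mul1r; exact: (congr1 fine (probability_setT P)). Qed.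

Let iP1 : P.-integrable setT (EFin \o (cst 1 : R -> R)).
Proof. exact: (finite_measure_integrable_cst P 1 measurableT). Qed.

Lemma uniform_integral_cos n : \int[P]_t cos (n.+1%:R * t) = 0.
Proof.
have n0 : n.+1%:R != 0 :> R by rewrite pnatr_eq0.
have [ic _] := integrable_cos_sin n.+1.
have dF t : is_derive t (1 : R) (fun t => t + n.+1%:R^-1 * sin (n.+1%:R * t))
    (cst 1 t + cos (n.+1%:R * t)).
  have d1 := is_derive1_comp (is_derive_sin (n.+1%:R * t)) (is_derive_mull n.+1%:R t).
  have d2 := is_deriveD (is_derive_id t (1 : R)) (is_deriveZ n.+1%:R^-1 d1).
  by move: d2 => /is_derive_eq; apply; rewrite /GRing.scale/= mulrCA mulVf// mulr1.
have cg : continuous (fun t : R => cst 1 t + cos (n.+1%:R * t)).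
  move=> t; apply: cvgD; first exact: cvg_cst.
  by apply: continuous_comp; [exact: mulrl_continuous|exact: continuous_cos].
have g0 t : 0 <= cst 1 t + cos (n.+1%:R * t) :> R by rewrite -lerBlDl sub0r cos_geN1.
have := uniform_integral_FTC dF cg g0.
rewrite sin_nat_2pi !mulr0 sin0 !mulr0 !addr0 subr0 divff ?gt_eqF ?two_pi_gt0//.
by rewrite RintegralD// P1 => /eqP; rewrite -subr_eq0 addrAC subrr add0r => /eqP.
Qed.

Lemma uniform_integral_sin n : \int[P]_t sin (n.+1%:R * t) = 0.
Proof.
have n0 : n.+1%:R != 0 :> R by rewrite pnatr_eq0.
have [_ ic] := integrable_cos_sin n.+1.
have dF t : is_derive t (1 : R) (fun t => t + (- n.+1%:R^-1) * cos (n.+1%:R * t))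
    (cst 1 t + sin (n.+1%:R * t)).
  have d1 := is_derive1_comp (is_derive_cos (n.+1%:R * t)) (is_derive_mull n.+1%:R t).
  have d2 := is_deriveD (is_derive_id t (1 : R)) (is_deriveZ (- n.+1%:R^-1) d1).
  move: d2 => /is_derive_eq; apply; rewrite /GRing.scale/= !mulNr mulrN opprK.
  by rewrite mulrCA mulVf// mulr1.
have cg : continuous (fun t : R => cst 1 t + sin (n.+1%:R * t)).
  move=> t; apply: cvgD; first exact: cvg_cst.
  by apply: continuous_comp; [exact: mulrl_continuous|exact: continuous_sin].
have g0 t : 0 <= cst 1 t + sin (n.+1%:R * t) :> R by rewrite -lerBlDl sub0r sin_geN1.
have := uniform_integral_FTC dF cg g0.
rewrite cos_nat_2pi mulr0 cos0 add0r addrK divff ?gt_eqF ?two_pi_gt0//.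
by rewrite RintegralD// P1 => /eqP; rewrite -subr_eq0 addrAC subrr add0r => /eqP.
Qed.

Lemma cis_exp n (t : R) :
  (cos t +i* sin t)%C ^+ n = (cos (n%:R * t) +i* sin (n%:R * t))%C :> R[i].
Proof.
elim: n => [|n IH]; first by rewrite expr0 mul0r cos0 sin0.
rewrite exprSr IH -natr1 mulrDl mul1r cosD sinD.
by apply/eqP; rewrite eq_complex/= eqxx/= addrC eqxx.
Qed.

Lemma cintegral_conj_pow_neq0 (k : int) : k != 0 -> cintegral m (@conj_pow R k) = 0.
Proof.
move=> k0; rewrite /cintegral.
have [[m1 c1 b1] [m2 c2 b2]] := complex_test_conj_pow R k.
have i1 : m.-integrable setT (EFin \o (fun z => complex.Re (conj_pow k z))).
  exact: bounded_integrable b1.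
have i2 : m.-integrable setT (EFin \o (fun z => complex.Im (conj_pow k z))).
  exact: bounded_integrable b2.
rewrite !Rintegral_arc_length//.
case: k k0 {m1 c1 b1 m2 c2 b2 i1 i2} => [[|n]|n] // _.
  have E t : conj_pow (Posz n.+1) (expi t) = (cos (n.+1%:R * t) +i* - sin (n.+1%:R * t))%C :> R[i].
    rewrite conj_powE (_ : (cval (expi t))^*%C = (cos (- t) +i* sin (- t))%C).
      by rewrite cis_exp mulrN cosN sinN.
    by rewrite cosN sinN.
  under eq_Rintegral do rewrite E/=; rewrite uniform_integral_cos.
  under eq_Rintegral do rewrite E/= -mulN1r.
  by rewrite RintegralZl ?uniform_integral_sin ?mulr0//; have [] := integrable_cos_sin n.+1.
have E t : conj_pow (Negz n) (expi t) = (cos (n.+1%:R * t) +i* sin (n.+1%:R * t))%C :> R[i].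
  by rewrite conj_powE /cval/= cis_exp.
under eq_Rintegral do rewrite E/=; rewrite uniform_integral_cos.
by under eq_Rintegral do rewrite E/=; rewrite uniform_integral_sin.
Qed.

Lemma cintegral_1 : cintegral m (fun=> 1 : R[i]) = 1.
Proof.
rewrite /cintegral/= !Rintegral_cst// mul1r mul0r.
by congr (_ +i* _)%C; exact: (congr1 fine (probability_setT m)).
Qed.

Lemma conj_powD (j k : int) z : conj_pow (j + k) z = conj_pow j z * conj_pow k z.
Proof.
rewrite /conj_pow expfzDr//; apply/eqP => z0.
have := normc_conj_pow 1 z; rewrite /conj_pow expr1z z0 Normc.normc0 => /eqP.
by rewrite eq_sym oner_eq0.
Qed.

Lemma L1_conj_pow k : L1 (@conj_pow R k).
Proof.
have [[m1 _ b1] [m2 _ b2]] := complex_test_conj_pow R k.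
by split; [exact: bounded_integrable b1|exact: bounded_integrable b2].
Qed.

Lemma fourier_monomial (j k : int) : fourier (@conj_pow R (- k)) j = (j == k)%:R.
Proof.
have E : (fun z => conj_pow j z * conj_pow (- k) z) = @conj_pow R (j - k).
  by apply/funext => z; rewrite conj_powD.
rewrite /fourier E; have [->|jk] := eqVneq j k.
  have -> : @conj_pow R (k - k) = fun=> 1; last exact: cintegral_1.
  by apply/funext => z; rewrite subrr /conj_pow expr0z.
by rewrite cintegral_conj_pow_neq0// subr_eq0.
Qed.

End orthogonality.

Lemma finite_poly_roots (F : fieldType) (p : {poly F}) :
  p != 0 -> exists s : seq F, forall x, root p x -> x \in s.
Proof.
have [n] := ubnP (size p); elim: n p => // n IH p pn p0.
have [[x px]|nroot] := pselect (exists x, root p x); last first.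
  by exists [::] => x px; case: nroot; exists x.
have /factor_theorem[q pE] := px.
have q0 : q != 0 by apply: contraNneq p0 => q0; rewrite pE q0 mul0r.
have [|s sP] := IH q _ q0.
  by move: pn; rewrite pE size_Mmonic ?monicXsubC// size_XsubC addn2.
exists (x :: s) => y; rewrite pE rootM root_XsubC inE => /orP[/sP ->|->//].
by rewrite orbT.
Qed.

(** * Points and zero sets of polynomials are null *)

Section null_sets.
Context (R : realType).
Notation m := (@arc_length R).
Notation P := (uniform_prob (@two_pi_gt0 R)).

(** Equal points give [cos (t - s) = 1], so the sine of the half difference vanishes; if [s < t]
    that half difference lies strictly between 0 and [pi], where the sine is positive. *)
Lemma expi_inj (s t : R) : 0 < s < 2 * pi -> 0 < t < 2 * pi ->
  expi s = expi t -> s = t.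
Proof.
wlog st : s t / s <= t => [H s2 t2 e|/andP[s0 s2] /andP[t0 t2] e].
  have [st|/ltW ts] := leP s t; first exact: H.
  by apply/esym; exact: H.
have cs : cos s = cos t := congr1 (fun z => complex.Re (cval z)) e.
have ss : sin s = sin t := congr1 (fun z => complex.Im (cval z)) e.
have c1 : cos (t - s) = 1 by rewrite cosB cs ss -!expr2 cos2Dsin2.
move: st; rewrite le_eqVlt => /predU1P[//|st].
pose d := (t - s) / 2.
have dE : t - s = d *+ 2 by rewrite -[RHS]mulr_natr divfK.
have : 0 < sin d.
  apply: sin_gt0_pi; rewrite divr_gt0 ?subr_gt0//= ltr_pdivrMr// mulrC.
  by rewrite ltrBlDr (lt_trans t2)// ltrDl.
have := c1; rewrite dE cos_mulr2n => c2.
have c2' : cos d ^+ 2 = 1 by move: c2; rewrite mulr2n; lra.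
have := cos2Dsin2 d; rewrite c2' => /eqP; rewrite -subr_eq0 addrAC subrr add0r.
by rewrite sqrf_eq0 => /eqP ->; rewrite ltxx.
Qed.

Lemma uniform_prob_point (s : R) : P [set s] = 0%E.
Proof.
have /null_content_dominatesP := dominates_uniform_prob (@two_pi_gt0 R).
by apply; [exact: measurable_set1|exact: lebesgue_measure_set1].
Qed.

Lemma measurable_circle_point (z0 : circle R) : measurable [set z0].
Proof.
rewrite (_ : [set z0] = coordinate (false, false) @^-1` [set coordinate (false, false) z0] `&`
   coordinate (false, true) @^-1` [set coordinate (false, true) z0]).
  by apply: measurableI; rewrite -[X in measurable X]setTI;
    apply: measurable_coordinate => //; exact: measurable_set1.
apply/seteqP; split=> z /= => [->//|]; rewrite /coordinate/= !mul1r => -[].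
by case: z z0 => [[a b] p] [[c d] q]; rewrite /cval/= => ? ?; apply: val_inj => /=; congr (_ +i* _)%C.
Qed.

(** The preimage under [expi] has at most one point in []0, 2 pi[], and the rest of the line is null
    for the uniform law. *)
Lemma arc_length_point (z0 : circle R) : m [set z0] = 0%E.
Proof.
rewrite -[LHS]/(P (@expi R @^-1` [set z0])).
set A := _ @^-1` _.
have mA : measurable A.
  by rewrite /A -[X in measurable X]setTI; apply: measurable_expi => //; exact: measurable_circle_point.
have [s sP] : exists s : R, forall t, 0 < t < 2 * pi -> A t -> t = s.
  have [[s [s2 As]]|nA] := pselect (exists s, 0 < s < 2 * pi /\ A s).
    by exists s => t t2 At; apply: expi_inj => //; rewrite At As.
  by exists 0 => t t2 At; case: nA; exists t.
have mI (i : interval R) : measurable ([set` i] : set (measurableTypeR R)).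
  exact: measurable_itv.
have m1 (r : R) : measurable ([set r] : set (measurableTypeR R)).
  exact: measurable_set1.
have sub : A `<=` (`]-oo, 0] `|` `]2 * pi, +oo[) `|` ([set 2 * pi] `|` [set s]).
  move=> t At; have [t0|t0] := leP t 0; first by left; left; rewrite /= in_itv.
  have [t2|t2|t2] := ltgtP t (2 * pi).
  - by right; right; apply: sP => //; rewrite t0 t2.
  - by left; right; rewrite /= in_itv/= andbT.
  - by right; left.
apply/eqP; rewrite -measure_le0 (le_trans (le_measure P _ _ sub)) ?inE//.
  by apply: measurableU; apply: measurableU.
rewrite (le_trans (measureU2 _ _ _))//; [exact: measurableU|exact: measurableU|].
rewrite -[leRHS]addr0 leeD// (le_trans (measureU2 _ _ _))//.
- by rewrite [X in (X + _)%E]uniform_prob_le0 [X in (_ + X)%E]uniform_prob_gt2pi adde0.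
- by rewrite [X in (X + _)%E]uniform_prob_point [X in (_ + X)%E]uniform_prob_point adde0.
Qed.

Lemma ae_poly_neq0 (p : {poly R[i]}) : p != 0 ->
  \forall z \ae m, ~~ root p (cval z).
Proof.
move=> /finite_poly_roots[s sP].
suff : \forall z \ae m, cval z \notin s.
  by apply: filterS => z; apply: contra => /sP.
elim: s {sP} => [|x s IH]; first exact: aeW.
suff xP : \forall z \ae m, cval z != x.
  by apply: filterS2 xP IH => z zx zs; rewrite inE negb_or zx.
have [[z0 z0x]|nx] := pselect (exists z0 : circle R, cval z0 = x); last first.
  by apply: aeW => z; apply/eqP => zx; apply: nx; exists z.
exists [set z0]; split; [exact: measurable_circle_point|exact: arc_length_point|].
by move=> z /= /negP/negPn/eqP zx; apply: val_inj; rewrite -[LHS]/(cval z) zx.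
Qed.

Lemma ae_real_poly_neq0 (p : {poly R}) : p != 0 ->
  \forall z \ae m, p.[complex.Re (cval z)] != 0.
Proof.
move=> /finite_poly_roots[s sP].
suff : \forall z \ae m, complex.Re (cval z) \notin s.
  by apply: filterS => z; apply: contra => pz; exact: sP.
elim: s {sP} => [|a s IH]; first exact: aeW.
suff aP : \forall z \ae m, complex.Re (cval z) != a.
  by apply: filterS2 aP IH => z za zs; rewrite inE negb_or za.
(* On the circle z plus its inverse is twice the real part, so a point with real part [a] is a root
   of [q]. *)
pose q : {poly R[i]} := 'X^2 - (2 * a)%:C%C *: 'X + 1.
have q0 : q != 0.
  apply/eqP => /(congr1 (fun r : {poly _} => r`_2)); rewrite /q !coefE/= mulr0 subr0 addr0.
  by move/eqP; rewrite oner_eq0.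
apply: filterS (ae_poly_neq0 q0) => z; apply: contra => /eqP za.
rewrite /root /q !hornerE.
have := sqr_norm_circle z; move: za; case: (cval z) => x y /= -> xy.
rewrite expr2; apply/eqP/eqP; rewrite eq_complex/=; apply/andP; split; apply/eqP.
  by move: xy; rewrite !expr2; lra.
by ring.
Qed.

End null_sets.

(** * Periodic and cofinite spectra *)

Section no_extreme_points.
Context (R : realType).
Notation m := (@arc_length R).
Implicit Types (f : circle R -> R[i]) (L : set int).

(** With [k] in [L], zero is the midpoint of z^k and its negative, both of norm 1. They differ
    everywhere, and the circle is not null. *)
Lemma zero_not_extreme L f : L !=set0 -> norm1 f = 0 ->
  ~ extreme_point (unit_ball L) f.
Proof.
move=> [k Lk] f0 [[[L1f sf] _]]; apply.
pose u := @conj_pow R (- k); pose v z := (-1) * u z.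
have Lu : L1_spec L u.
  apply/L1_specP; split=> [|j nLj]; first exact: L1_conj_pow.
  rewrite fourier_monomial; case: eqP => // jk.
  by rewrite jk in nLj.
have n1 (g : circle R -> R[i]) : (forall z, Normc.normc (g z) = 1) -> norm1 g <= 1.
  move=> g1; rewrite /norm1; under eq_Rintegral do rewrite g1.
  rewrite Rintegral_cst// mul1r.
  by rewrite le_eqVlt; apply/orP; left; apply/eqP; exact: (congr1 fine (probability_setT m)).
have u1 z : Normc.normc (u z) = 1 by exact: normc_conj_pow.
exists u, v; split.
- by split=> //; exact: n1.
- split; first exact: L1_specZ.
  by apply: n1 => z; rewrite /v Normc.normcM u1 mulr1 /= oppr0 expr0n/= addr0 sqrtr_sqr normrN1.
- move=> [N [mN N0 uvN]].
  have : (m setT <= m N)%E.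
    apply: le_measure; rewrite ?inE//; apply: subset_trans uvN => z _ /= /(_ I).
    rewrite /v mulN1r => /eqP; rewrite -addr_eq0 -mulr2n mulrn_eq0/= => /eqP uz.
    by have := u1 z; rewrite uz Normc.normc0 => /eqP; rewrite eq_sym oner_eq0.
  by rewrite N0 [X in (X <= _)%E]probability_setT lee_fin ler10.
- apply: filterS (norm1_eq0_ae L1f f0) => z /= /(_ I) -> _.
  by rewrite /v mulN1r subrr mulr0.
Qed.

Lemma conj_powN_nat (n : nat) (z : circle R) : conj_pow (- n%:Z) z = cval z ^+ n.
Proof. by rewrite conj_powE; case: n => // n; rewrite oppr0. Qed.

Lemma fourier_shift f (j k : int) :
  fourier (fun z => conj_pow j z * f z) k = fourier f (k + j).
Proof.
by rewrite /fourier; congr cintegral; apply/funext => z; rewrite conj_powD mulrA.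
Qed.

(** Multiplying by a character translates the spectrum. The two inclusions in the periodicity of [L]
    handle the two directions. *)
Lemma periodic_shift L f (n : nat) : [set k + n%:Z | k in L] = L -> L1_spec L f ->
  L1_spec L (fun z => conj_pow n z * f z) /\ L1_spec L (fun z => conj_pow (- n%:Z) z * f z).
Proof.
move=> LE /L1_specP[L1f sf].
have L1s j : L1 (fun z => conj_pow j z * f z).
  by apply: L1_testM => //; exact: complex_test_conj_pow.
split; apply/L1_specP; split=> // k nLk; rewrite fourier_shift sf//.
  by rewrite -LE => -[l Ll /addIr lk]; apply: nLk; rewrite -lk.
by move=> Lkn; apply: nLk; rewrite -LE; exists (k - n%:Z) => //; rewrite subrK.
Qed.

Lemma periodic_not_extreme L f : periodic_set L -> norm1 f != 0 ->
  ~ extreme_point (unit_ball L) f.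
Proof.
move=> [n [n0 LE]] f0 ef; have [[Lf _] _] := ef; have [L1f _] := Lf.
pose e := @conj_pow R (- n%:Z).
have te : complex_test e := complex_test_conj_pow R _.
pose w1 := \int[m]_z (complex.Re (e z) * Normc.normc (f z)).
pose w2 := \int[m]_z (complex.Im (e z) * Normc.normc (f z)).
(* Orthogonality of [h] to the modulus of [f] is one real linear equation in two real unknowns, so
   it has a nonzero solution; dividing by [s] gives the bound 1. *)
have [a [b [ab0 abw]]] : exists a b : R, 0 < `|a| + `|b| /\ a * w1 + b * w2 = 0.
  have [w10|w10] := eqVneq w1 0.
    by exists 1, 0; rewrite normr1 normr0 addr0 ltr01 w10 mulr0 mul0r addr0.
  exists w2, (- w1); split; last by ring.
  by rewrite ltr_wpDl// normrN normr_gt0.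
pose s := `|a| + `|b|.
pose h z := (a * complex.Re (e z) + b * complex.Im (e z)) / s.
have [[m1 _ b1] [m2 _ b2]] := te.
have mh : measurable_fun setT h.
  apply: measurable_funM => //; apply: measurable_funD; exact: measurable_funM.
have h1 z : `|h z| <= 1.
  rewrite normrM normfV [`|s|]gtr0_norm// ler_pdivrMr// mul1r.
  rewrite (le_trans (ler_normD _ _))// !normrM; apply: lerD.
    by rewrite -[leRHS]mulr1; apply: ler_wpM2l => //; exact: b1.
  by rewrite -[leRHS]mulr1; apply: ler_wpM2l => //; exact: b2.
have ifn := integrable_normc L1f.
(* Chosen so that [h] is twice the real part of [alpha * e z]; thus [h f] is a combination of the
   two shifts of [f] from [periodic_shift]. *)
pose alpha : R[i] := (a / (2 * s) +i* - (b / (2 * s)))%C.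
have eC z : conj_pow n z = ((e z)^*)%C.
  by rewrite /e conj_powN_nat conj_powE rmorphXn.
have hE z : (h z)%:C%C = alpha * e z + alpha^*%C * conj_pow n z.
  rewrite eC /h /alpha; case: (e z) => x y.
  have s0 : s != 0 by rewrite gt_eqF.
  by apply/eqP; rewrite eq_complex/=; apply/andP; split; apply/eqP; field.
apply: (@perturbation_not_extreme _ L f h) ef => //.
- move=> _; have [Ln LNn] := periodic_shift LE Lf.
  have := L1_specD (L1_specZ alpha LNn) (L1_specZ alpha^*%C Ln).
  congr L1_spec; apply/funext => z.
  by rewrite hE mulrDl !mulrA.
- rewrite /h; under eq_Rintegral do rewrite mulrAC mulrDl -!mulrA.
  have i1 := integrableM_bounded m1 b1 ifn; have i2 := integrableM_bounded m2 b2 ifn.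
  have i1a := integrableZl measurableT a i1; have i2b := integrableZl measurableT b i2.
  under eq_Rintegral do rewrite mulrC.
  rewrite RintegralZl//; last exact: (integrableD measurableT i1a i2b).
  by rewrite RintegralD// !RintegralZl// abw mulr0.
move=> hf0; move/negP: f0; apply; apply/eqP.
(* On the circle [p] equals z^n times [h], so zeros of [h] are roots of [p]. As [n] is positive, the
   two terms have different degrees and [p] is nonzero. *)
pose p : {poly R[i]} := alpha *: 'X^(n + n) + (alpha^*%C)%:P.
have alpha0 : alpha != 0.
  rewrite /alpha eq_complex/= negb_and oppr_eq0 !mulf_eq0 !invr_eq0 !mulf_eq0 pnatr_eq0/= (gt_eqF ab0) !orbF.
  by rewrite -negb_and; apply: contraTN ab0 => /andP[/eqP -> /eqP ->]; rewrite normr0 addr0 ltxx.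
have p0 : p != 0.
  apply/eqP => /(congr1 (fun r : {poly _} => r`_(n + n))).
  rewrite /p !coefE eqxx addn_eq0.
  by rewrite (gtn_eqF n0)/= mulr1 addr0 => /eqP; rewrite (negbTE alpha0).
have : ae_eq m setT f (fun=> 0).
  apply: filterS2 hf0 (ae_poly_neq0 p0) => z /= /(_ I) hfz pz _.
  move/eqP: hfz; rewrite mulf_eq0 => /orP[|/eqP//]; rewrite hE => /eqP hz.
  move: pz; rewrite /root /p !hornerE.
  have ez : e z = cval z ^+ n := conj_powN_nat n z.
  have ee : conj_pow n z * e z = 1.
    by rewrite -conj_powD subrr /conj_pow expr0z.
  rewrite exprD -ez => /negP; case.
  rewrite (_ : _ + _ = e z * (alpha * e z + alpha^*%C * conj_pow n z)); first by rewrite hz mulr0.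
  by rewrite mulrDr; congr (_ + _); rewrite mulrCA// [e z * _]mulrC ee mulr1.
move=> f0; rewrite /norm1 /Rintegral (ae_eq_integral (cst 0%E))//; first by rewrite integral0.
  by case/integrableP: ifn.
by apply: filterS f0 => z /= /(_ I) -> _; rewrite Normc.normc0.
Qed.

(* deg p < #|I| + 1 leaves #|I| + 1 free coefficients for #|I| linear conditions. *)
Lemma poly_annihilator (I : finType) (g : I -> circle R -> R) :
  (forall i, m.-integrable setT (EFin \o g i)) ->
  exists2 p : {poly R}, p != 0 &
    forall i, \int[m]_z (p.[complex.Re (cval z)] * g i z) = 0.
Proof.
move=> ig; pose K := #|I|.
pose x (z : circle R) : R := complex.Re (cval z).
have mx : measurable_fun setT x.
  have := @measurable_coordinate R (false, false); congr measurable_fun.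
  by apply/funext => z; rewrite /coordinate/= mul1r.
have x1 z : `|x z| <= 1.
  by have := coordinate_le1 (false, false) z; rewrite /coordinate/= mul1r.
have ixg n i : m.-integrable setT (EFin \o (fun z => x z ^+ n * g i z)).
  apply: (integrableM_bounded (M := 1)) => //; first exact: measurable_funX.
  by move=> z; rewrite normrX exprn_ile1.
pose M : 'M[R]_(K.+1, K) := \matrix_(n, i) \int[m]_z (x z ^+ n * g (enum_val i) z).
have kM : kermx M != 0.
  by rewrite -mxrank_eq0 mxrank_ker -lt0n subn_gt0 ltnS rank_leq_col.
pose u := nz_row (kermx M).
have u0 : u != 0 by rewrite nz_row_eq0.
have uM : u *m M = 0 by apply/sub_kermxP; exact: nz_row_sub.
exists (\poly_(n < K.+1) u 0 (inord n)).
  apply: contra u0 => /eqP p0; apply/eqP/rowP => n; rewrite mxE.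
  have := congr1 (fun r : {poly R} => r`_n) p0; rewrite coef_poly ltn_ord coef0.
  by rewrite inord_val.
move=> i; have /rowP/(_ (enum_rank i)) := uM; rewrite !mxE => <-.
rewrite (_ : (fun z => _) = fun z => \sum_(n < K.+1) u 0 n * (x z ^+ n * g i z)).
  rewrite /Rintegral; under eq_integral do rewrite -sumEFin.
  rewrite integral_sum//; last first.
    by move=> n; exact: (integrableZl measurableT (u 0 n) (ixg n i)).
  rewrite (_ : (\sum_(n < K.+1) _)%E =
      (\sum_(n < K.+1) (u 0 n * \int[m]_z (x z ^+ n * g i z))%:E)%E).
    by rewrite sumEFin/=; apply: eq_bigr => n _; rewrite mxE enum_rankK.
  apply: eq_bigr => n _; rewrite -RintegralZl// /Rintegral fineK//.
  exact: integrable_fin_num (integrableZl measurableT (u 0 n) (ixg n i)).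
apply/funext => z; rewrite horner_poly mulr_suml; apply: eq_bigr => n _.
by rewrite inord_val mulrA.
Qed.

Lemma cofinite_not_extreme L f : finite_set (~` L) -> norm1 f != 0 ->
  ~ extreme_point (unit_ball L) f.
Proof.
move=> /finite_seqP[s sL] f0 ef; have [[Lf _] _] := ef; have [L1f _] := Lf.
have ifn := integrable_normc L1f.
pose c k z := conj_pow k z * f z.
have L1c k : L1 (c k) by apply: L1_testM => //; exact: complex_test_conj_pow.
(* The linear conditions on [h]: [None] makes both perturbations keep the norm, and the real and
   imaginary parts for each excluded frequency keep the spectrum of [h f] inside [L]. *)
pose g (i : option ('I_(size s) * bool)) z : R :=
  match i with
  | None => Normc.normc (f z)
  | Some (j, false) => complex.Re (c s`_j z)
  | Some (j, true) => complex.Im (c s`_j z)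
  end.
have ig i : m.-integrable setT (EFin \o g i).
  by case: i => [[j []]|] //; [exact: (L1c _).2|exact: (L1c _).1].
have [p p0 pg] := poly_annihilator ig.
have [B pB] := poly_disk_bound p 1.
(* [B] bounds [p] on [[-1, 1]], where the real part of a circle point lies; adding 1 makes the
   divisor positive. *)
pose D := `|B| + 1.
have D0 : 0 < D by rewrite ltr_wpDl.
pose h z := p.[complex.Re (cval z)] / D.
have Re1 (z : circle R) : `|complex.Re (cval z)| <= 1.
  by rewrite -(normc_circle z) Re_le_normc.
have mh : measurable_fun setT h.
  apply: measurable_funM => //.
  under eq_fun do rewrite horner_coef.
  apply: measurable_sum => i; apply: measurable_funM => //; apply: measurable_funX.
  have := @measurable_coordinate R (false, false); congr measurable_fun.
  by apply/funext => z; rewrite /coordinate/= mul1r.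
have h1 z : `|h z| <= 1.
  rewrite normrM normfV [`|D|]gtr0_norm// ler_pdivrMr// mul1r.
  rewrite (le_trans (pB _ (Re1 z)))// (le_trans (ler_norm _))// lerDl//.
have hg i : \int[m]_z (h z * g i z) = 0.
  have ipg : m.-integrable setT (EFin \o (fun z => h z * g i z)).
    exact: integrableM_bounded (ig i).
  apply: (mulfI (lt0r_neq0 D0)); rewrite -RintegralZl// mulr0 -[RHS](pg i).
  by apply: eq_Rintegral => z _; rewrite /h mulrA mulrCA divff ?gt_eqF// mulr1.
apply: (@perturbation_not_extreme _ L f h) ef => //; last first.
- move=> hf0; move/negP: f0; apply; apply/eqP.
  have f0 : ae_eq m setT f (fun=> 0).
    apply: filterS2 hf0 (ae_real_poly_neq0 p0) => z /= /(_ I) /eqP + pz _.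
    rewrite mulf_eq0 => /orP[|/eqP//]; rewrite eq_complex/= eqxx andbT.
    by rewrite mulf_eq0 (negbTE pz) invr_eq0 gt_eqF.
  rewrite /norm1 /Rintegral (ae_eq_integral (cst 0%E))//; first by rewrite integral0.
    by case/integrableP: ifn.
  by apply: filterS f0 => z /= /(_ I) -> _; rewrite Normc.normc0.
- exact: (hg None).
move=> _; apply/L1_specP; split; first exact: L1_realM.
move=> k nLk; have : (~` L) k by [].
rewrite sL /= => ks; have ksi : (index k s < size s)%N by rewrite index_mem.
have kE : s`_(Ordinal ksi) = k by rewrite /= nth_index.
have hc z : conj_pow k z * ((h z)%:C%C * f z) = (h z)%:C%C * c k z by rewrite mulrCA.
rewrite /fourier /cintegral; apply/eqP; rewrite eq_complex; apply/andP; split; apply/eqP => /=.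
  rewrite -[RHS](hg (Some (Ordinal ksi, false))) /g kE.
  by apply: eq_Rintegral => z _; rewrite hc; case: (c k z) => a b; rewrite /= mul0r subr0.
rewrite -[RHS](hg (Some (Ordinal ksi, true))) /g kE.
by apply: eq_Rintegral => z _; rewrite hc; case: (c k z) => a b; rewrite /= mul0r addr0.
Qed.

Lemma cofinite_nonempty L : finite_set (~` L) -> L !=set0.
Proof.
move=> fL; apply/set0P/eqP => L0; move: fL; rewrite L0 setC0 => fT.
have : finite_set (Posz @^-1` [set: int]).
  by apply: finite_preimage => // x y _ _ [].
by rewrite preimage_setT; exact: infinite_nat.
Qed.

End no_extreme_points.

Theorem theorem2p1 (R : realType) (L : set int) :
  ((L !=set0 /\ periodic_set L) \/ finite_set (~` L) ->
     ~ exists f : circle R -> R[i], extreme_point (unit_ball L) f)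
  /\
  (Riesz_set R L ->
     exists f : circle R -> R[i], extreme_point (unit_ball L) f).
Proof.
split; last exact: riesz_extreme_point.
move=> LP [f ef]; have [f0|f0] := eqVneq (norm1 f) 0.
  apply: zero_not_extreme f0 ef.
  by case: LP => [[]//|]; exact: cofinite_nonempty.
case: LP => [[_ perL]|finL]; first exact: periodic_not_extreme ef.
exact: cofinite_not_extreme ef.
Qed.
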